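(* Let $G$ be a Polish group, $X$ a quasi-Polish $G$-space (continuous action), $2 \le \xi < \omega_1$, and $A_i \in \boldsymbol{\Sigma}^0_\xi(X)$ countably many sets. Then there is a Polish topology on $X$, finer than the original topology and contained in $\boldsymbol{\Sigma}^0_\xi(X)$, containing each set $U * A_i$ for $U \subseteq G$ open and all $i$, for which the action is still continuous. If moreover $G$ is non-Archimedean, this topology can be taken to be zero-dimensional. In particular, if $A_i$ is $G$-invariant then $A_i$ itself can be made open in such a topology.
   Context: Borel hierarchy (Selivanov) for general spaces: $\boldsymbol{\Sigma}^0_1$ = open; $\boldsymbol{\Sigma}^0_2$ = countable unions of $U \setminus V$ with $U,V$ open; for $\xi > 2$, $\boldsymbol{\Sigma}^0_\xi$ = countable unions of $U_i \setminus V_i$ with $U_i, V_i \in \boldsymbol{\Sigma}^0_{\zeta_i}$, $\zeta_i < \xi$. Quasi-Polish is in the sense of de Brecht. Vaught transform: $U * A := \{x \in X \mid \exists^* g \in G\,(g \in U \text{ and } x \in gA)\}$ ($\exists^*$ = ''for nonmeagerly many''). A Polish group is non-Archimedean if the identity has a neighborhood basis of open subgroups. *)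

(* Defs.v *)
From HB Require Import structures.
From mathcomp Require Import all_boot all_order all_algebra.
From mathcomp Require Import all_classical all_reals all_analysis.

Set Implicit Arguments.
Unset Strict Implicit.
Unset Printing Implicit Defensive.

Import Order.TTheory GRing.Theory Num.Theory.

Local Open Scope classical_set_scope.
Local Open Scope ring_scope.

HB.mixin Record isTopologicalGroup G & Group G & Topological G := {
  mulg_continuous : continuous (fun p : G * G => (p.1 * p.2)%g);
  invg_continuous : continuous (fun x : G => (x^-1)%g)
}.

#[short(type="topologicalGroupType")]
HB.structure Definition TopologicalGroup :=
  {G of Group G & Topological G & isTopologicalGroup G}.

Section QuasiMetrics.
Context {R : realType} {T : Type}.
Implicit Type d : T -> T -> R.

Definition quasi_metric d :=
  [/\ forall x y, 0 <= d x y,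
      forall x y, x = y <-> d x y = 0 /\ d y x = 0
    & forall x y z, d x z <= d x y + d y z].

Definition metric d := quasi_metric d /\ forall x y, d x y = d y x.

(* The balls {y | d x y < e} have their centre as first argument of d, and the
   index order m <= n in Cauchy sequences matters when d is not symmetric. *)
Definition quasi_cauchy d (u : nat -> T) :=
  forall e : R, 0 < e -> exists N : nat, forall m n : nat,
    (N <= m)%N -> (m <= n)%N -> d (u m) (u n) < e.

(* Completeness in the sense of Smyth and de Brecht: convergence is for the
   symmetrized metric max (d x y) (d y x). *)
Definition quasi_complete d :=
  forall u, quasi_cauchy d u -> exists x, forall e : R, 0 < e ->
    exists N : nat, forall n : nat, (N <= n)%N ->
      Num.max (d x (u n)) (d (u n) x) < e.

End QuasiMetrics.

Definition compatible (R : realType) (T : topologicalType) (d : T -> T -> R) :=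
  forall U : set T, open U <->
    forall x, U x -> exists2 e : R, 0 < e & [set y | d x y < e] `<=` U.

Definition quasi_polish (R : realType) (T : topologicalType) :=
  @second_countable T /\
  exists d : T -> T -> R, [/\ quasi_metric d, compatible d & quasi_complete d].

(* For a symmetric d, quasi_complete is the usual completeness of metrics. *)
Definition polish (R : realType) (T : topologicalType) :=
  @second_countable T /\
  exists d : T -> T -> R, [/\ metric d, compatible d & quasi_complete d].

(* A basis of clopen sets; the library's zero_dimensional only asks that points
   be separated by clopen sets, which is weaker. *)
Definition has_clopen_basis (T : topologicalType) := basis (@clopen T).

Definition nowhere_dense (T : topologicalType) (A : set T) :=
  interior (closure A) = set0.

Definition meager (T : topologicalType) (A : set T) :=
  exists2 F : nat -> set T,
    forall n, nowhere_dense (F n) & A `<=` \bigcup_n F n.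

Definition open_subgroup (G : topologicalGroupType) (H : set G) :=
  [/\ open H, H 1%g, forall x y, H x -> H y -> H (x * y)%g
    & forall x, H x -> H (x^-1)%g].

Definition non_archimedean (G : topologicalGroupType) :=
  forall U : set G, nbhs (1%g : G) U ->
    exists2 H : set G, open_subgroup H & H `<=` U.

(* The Borel hierarchy of T, with its levels 1 <= xi < omega_1 represented by
   the elements of a well-order W, whose least element stands for 1. The second
   constructor never applies at the least element; at the next one (xi = 2) all
   the zeta i are least, so that it gives the countable unions of differences
   of open sets. *)
Inductive Sigma0 (d : Order.disp_t) (W : orderType d) (T : topologicalType) :
    W -> set T -> Prop :=
| Sigma0_open (xi : W) (U : set T) :
    (forall zeta : W, (xi <= zeta)%O) -> open U -> Sigma0 xi U
| Sigma0_bigcup (xi : W) (zeta : nat -> W) (U V : nat -> set T) :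
    (forall i, (zeta i < xi)%O) ->
    (forall i, Sigma0 (zeta i) (U i)) -> (forall i, Sigma0 (zeta i) (V i)) ->
    Sigma0 xi (\bigcup_i (U i `\` V i)).

Definition well_ordered (d : Order.disp_t) (W : orderType d) :=
  well_founded (fun x y : W => (x < y)%O).

Record topology (X : Type) := Topology {
  is_open :> set X -> Prop;
  is_openT : is_open setT;
  is_openI : setI_closed is_open;
  is_open_bigcup : forall F : set (set X),
    F `<=` is_open -> is_open (\bigcup_(U in F) U)
}.

(* The set X with the topology t in place of any topology X may carry. *)
Definition retop (X : choiceType) (t : topology X) : Type := X.

Section Retop.
Context {X : choiceType} (t : topology X).

Let is_open_bigU (I : Type) (f : I -> set X) :
  (forall i, t (f i)) -> t (\bigcup_i f i).
Proof.
move=> tf; have -> : \bigcup_i f i = \bigcup_(U in range f) U.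
  by rewrite bigcup_image.
by apply: is_open_bigcup => _ [i _ <-].
Qed.

HB.instance Definition _ := Choice.on (retop t).
HB.instance Definition _ := isOpenTopological.Build (retop t)
  (is_openT t) (@is_openI X t) is_open_bigU.

Lemma retop_openE (A : set X) : @open (retop t) A = t A.
Proof. by []. Qed.

End Retop.

Definition continuous_action (G : topologicalGroupType) (X : topologicalType)
    (act : G -> X -> X) :=
  [/\ forall x, act 1%g x = x,
      forall g h x, act (g * h)%g x = act g (act h x)
    & continuous (fun p : G * X => act p.1 p.2)].

Section Actions.
Context {G : topologicalGroupType} {X : topologicalType}.
Variable act : G -> X -> X.

Definition invariant_set (A : set X) := forall g, act g @` A = A.

Definition vaught_transform (U : set G) (A : set X) : set X :=
  [set x | ~ meager [set g | U g /\ (act g @` A) x]].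

Definition good_refinement (R : realType) (d : Order.disp_t) (W : orderType d)
    (xi : W) (I : Type) (A : I -> set X) (t : topology X) :=
  [/\ polish R (retop t),
      @open X `<=` t,
      t `<=` Sigma0 xi,
      forall (U : set G) (i : I), open U -> t (vaught_transform U (A i))
    & @continuous_action G (retop t) act] /\
  forall i : I, invariant_set (A i) -> t (A i).

End Actions.

(* Main.v *)
Require Import Defs.
From HB Require Import structures.
From mathcomp Require Import all_boot all_order all_algebra.
From mathcomp Require Import all_classical all_reals all_analysis.
From mathcomp Require Import lra.

Set Implicit Arguments.
Unset Strict Implicit.
Unset Printing Implicit Defensive.

Import Order.TTheory GRing.Theory Num.Theory.
Import numFieldNormedType.Exports.

Local Open Scope classical_set_scope.
Local Open Scope ring_scope.

(** Let L be a countable lattice of sets of level below xi that contains a basis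
    of X and the sets from which the A_i are built, and that is closed under the
    operations u * _ for u in a countable basis of G and under decomposition into
    sets of lower level. The new topology has the sets u * (B \ C), with B and C
    in L, as a basis. By the property of Baire u * (B \ C) is the union of the
    v * B \ v * C over the basic v included in u; since L is closed under v * _,
    this makes the action continuous and the new topology regular.

    Completeness is handled by a form of Choquet's criterion, the existence of a
    complete sieve, which passes to products, to finer topologies making the sets
    of L clopen, to Pi^0_2 subsets, and to open continuous images. The new
    topology is the image, under the open map (g, y) |-> g y, of the Pi^0_2 set of
    generic points of G x X, where X has the topology making L clopen. Finally, a
    regular second countable T_0 space with a complete sieve is Polish: Urysohn
    functions for countably many sets of the sieve, together with the inverses of
    functions that would vanish at the missing limits, define a complete
    metric. *)

(** * Complete sieves *)

Lemma countable_enum (S : Type) (D : set S) (s0 : S) : countable D ->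
  exists e : nat -> S, (forall n, D (e n) \/ e n = s0) /\
    forall x, D x -> exists n, e n = x.
Proof.
move=> /countable_injP[f finj].
have /choice[e eP] : forall n : nat, exists s,
    (D s /\ f s = n) \/ ((~ exists t, D t /\ f t = n) /\ s = s0).
  move=> n; have [[t Dt]|ne] := pselect (exists t, D t /\ f t = n).
    by exists t; left.
  by exists s0; right.
exists e; split=> [n|x Dx]; first by case: (eP n) => [[]|[]]; [left|right].
exists (f x); case: (eP (f x)) => [[De fe]|[ne _]].
  by apply: finj => //; rewrite inE.
by case: ne; exists x.
Qed.

Lemma second_countable_enum (T : topologicalType) : @second_countable T ->
  exists b : nat -> set T, (forall n, open (b n)) /\
    forall x O, open O -> O x -> exists n, b n x /\ b n `<=` O.
Proof.
move=> [B cB [Bo Bb]]; have [e [eB Be]] := countable_enum set0 cB.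
exists e; split=> [n|x O oO Ox].
  by case: (eB n) => [/Bo//|->]; exact: open0.
have [] := Bb x O; first exact: open_nbhs_nbhs.
move=> U [/Be[n <-] Ux] UO; by exists n.
Qed.

(** For each pair of enumerated basic sets with a member of [B] between them, one such member is
    chosen; these countably many choices still form a basis. *)
Lemma second_countable_basis_enum (T : topologicalType)
    (B : set (set T)) : @second_countable T -> B `<=` open ->
  (forall x O, open O -> O x -> exists2 U, B U & U x /\ U `<=` O) ->
  exists b : nat -> set T, (forall n, B (b n) \/ b n = set0) /\
    forall x O, open O -> O x -> exists n, b n x /\ b n `<=` O.
Proof.
move=> /second_countable_enum[e [eo eb]] Bo Bb.
have /choice[c cP] : forall p : nat * nat, exists V,
    [/\ B V, e p.1 `<=` V & V `<=` e p.2] \/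
    (V = set0 /\ ~ exists V, [/\ B V, e p.1 `<=` V & V `<=` e p.2]).
  move=> p.
  have [[V VP]|nV] := pselect (exists V, [/\ B V, e p.1 `<=` V & V `<=` e p.2]).
    by exists V; left.
  by exists set0; right.
exists (fun n => if unpickle n is Some p then c p else set0); split=> [n|x O oO Ox].
  by case: unpickle => [p|]; [case: (cP p) => [[]|[]]; [left|right]|right].
have [k [kx kO]] := eb _ _ oO Ox.
have [V BV [Vx Vk]] := Bb _ _ (eo k) kx.
have [m [mx mV]] := eb _ _ (Bo _ BV) Vx.
exists (pickle (m, k)); rewrite pickleK.
case: (cP (m, k)) => [[_ mc ck]|[_ []]]; last by exists V.
by split; [exact: mc|exact: subset_trans ck kO].
Qed.

Lemma dependent_choice_on (S : Type) (Q : nat -> S -> Prop)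
    (r : nat -> S -> S -> Prop) (s0 : S) : Q 0%N s0 ->
  (forall n s, Q n s -> exists t, r n s t /\ Q n.+1 t) ->
  exists2 u : nat -> S, u 0%N = s0 & forall n, Q n (u n) /\ r n (u n) (u n.+1).
Proof.
move=> Q0 step.
have /choice[f fP] : forall p : nat * S, exists t,
    Q p.1 p.2 -> r p.1 p.2 t /\ Q p.1.+1 t.
  move=> [n s]; have [/step[t tP]|nQ] := pselect (Q n s); first by exists t.
  by exists s.
pose u := fix u n := if n is m.+1 then f (m, u m) else s0.
have uQ : forall n, Q n (u n) by elim=> [//|n /(fP (n, u n))[]].
by exists u => // n; split=> //; case: (fP (n, u n) (uQ n)).
Qed.

Section Sieve.
Context {T : topologicalType} {J : Type}.
Variables (U : J -> set T) (r : J -> J -> Prop).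

(* Choquet's criterion with a strategy that depends on the last move only: the
   indices play the role of the moves, and the U (s n) along an r-chain s shrink
   to a point. *)
Definition sieve :=
  [/\ forall j, open (U j),
      forall j k, r j k -> U k `<=` U j,
      forall x, exists j, U j x,
      forall j x O, U j x -> open O -> O x ->
        exists k, [/\ r j k, U k x & U k `<=` O]
    & forall s : nat -> J, (forall n, r (s n) (s n.+1)) ->
        exists x, (forall n, U (s n) x) /\
          forall O, open O -> O x -> exists n, U (s n) `<=` O].

Lemma sieve_chain_subset (s : nat -> J) (m n : nat) : sieve ->
  (forall n, r (s n) (s n.+1)) -> (m <= n)%N -> U (s n) `<=` U (s m).
Proof.
move=> [_ mono _ _ _] sr /subnK <-; elim: (n - m)%N => [//|k IH].
by rewrite addSn; apply: subset_trans IH; exact: mono.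
Qed.

End Sieve.

Definition sieve_complete (T : topologicalType) :=
  exists (J : Type) (U : J -> set T) (r : J -> J -> Prop), sieve U r.

Lemma quasi_ball_open (R : realType) (T : topologicalType) (d : T -> T -> R)
    (x : T) (e : R) : quasi_metric d -> compatible d ->
  open [set y | d x y < e].
Proof.
move=> [_ _ tri] cd; apply/cd => y /= dxy; exists (e - d x y).
  by rewrite subr_gt0.
by move=> z /= dyz; have := tri x y z; lra.
Qed.

(** The sieve consists of balls that carry their centre and radius. A step at least halves the
    radius and leaves a strict gap in the triangle inequality; the centres of a chain form a Cauchy
    sequence, with the indices in the order that an asymmetric distance demands. *)
Lemma quasi_complete_sieve (R : realType) (T : topologicalType)
    (d : T -> T -> R) : quasi_metric d -> compatible d -> quasi_complete d ->
  sieve_complete T.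
Proof.
move=> qd cd dc; have [d0 dE tri] := qd.
have dxx x : d x x = 0 by have [/(_ erefl)[]] := dE x x.
exists (T * {e : R | 0 < e})%type, (fun p => [set y | d p.1 y < sval p.2]),
  (fun p q => d p.1 q.1 + sval q.2 < sval p.2 /\ sval q.2 <= sval p.2 / 2).
split.
- by move=> p; exact: quasi_ball_open.
- move=> p q [pq _] y /= qy; have := tri p.1 q.1 y; lra.
- by move=> x; exists (x, exist _ 1 ltr01); rewrite /= dxx.
- move=> [x [e e0]] y O /= xy oO Oy.
  have [e1 e10 e1O] := (cd O).1 oO _ Oy.
  (* The three bounds give, in turn, inclusion in [O], the strict gap and the halving. *)
  pose e2 := Num.min e1 (Num.min ((e - d x y) / 2) (e / 2)).
  have e20 : 0 < e2.
    by rewrite !lt_min e10 !divr_gt0// subr_gt0.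
  have [h1 h2 h3] : [/\ e2 <= e1, e2 <= (e - d x y) / 2 & e2 <= e / 2].
    by split; rewrite /e2 !ge_min lexx ?orbT.
  exists (y, exist _ e2 e20); split=> /=.
  + by split; lra.
  + by rewrite dxx.
  + by move=> z /= yz; apply: e1O => /=; lra.
- move=> s sr; pose x n := (s n).1; pose e n := sval (s n).2.
  have e0 n : 0 < e n by exact: svalP (s n).2.
  have step n : d (x n) (x n.+1) + e n.+1 < e n by have [] := sr n.
  have half n : e n.+1 <= e n / 2 by have [] := sr n.
  have far m k : d (x m) (x (k + m)%N) + e (k + m)%N <= e m.
    elim: k => [|k IH]; first by rewrite add0n dxx add0r.
    by have := step (k + m)%N; have := tri (x m) (x (k + m)%N) (x (k.+1 + m)%N);
      rewrite addSn; lra.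
  have efar m k : e (k + m)%N <= e m by have := far m k; have := d0 (x m) (x (k + m)%N); lra.
  have egeo n : e n <= e 0%N / 2 ^+ n.
    elim: n => [|n IH]; first by rewrite expr0 divr1.
    apply: le_trans (half n) _; rewrite exprSr invfM mulrA.
    by rewrite ler_wpM2r// invr_ge0.
  have esmall c : 0 < c -> exists n, e n < c.
    move=> c0.
    have [n nP] : exists n : nat, e 0%N / c < n%:R.
      by exists (Num.bound (e 0%N / c)); apply: archi_boundP; rewrite divr_ge0// ltW.
    exists n; apply: le_lt_trans (egeo n) _.
    rewrite ltr_pdivrMr ?exprn_gt0// mulrC -ltr_pdivrMr//.
    apply: lt_trans nP _; rewrite -natrX ltr_nat; exact: ltn_expl.
  have [c c0|z zP] := dc x.
    have [N Nc] := esmall c c0; exists N => m n Nm mn.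
    have := far m (n - m)%N; rewrite subnK// => h.
    have := efar N (m - N)%N; rewrite subnK// => h'.
    by have := e0 n; lra.
  have lim c : 0 < c -> forall M, exists n, [/\ (M <= n)%N, d z (x n) < c & d (x n) z < c].
    move=> c0 M; have [N NP] := zP c c0; exists (maxn M N).
    by have := NP (maxn M N) (leq_maxr _ _); rewrite gt_max => /andP[]; rewrite leq_maxl.
  exists z; split=> [n|O oO Oz] /=.
    rewrite -/(x n) -/(e n).
    (* The strict gap absorbs the distance from a late centre to the limit, which therefore stays in
       the open ball. *)
    have gap : 0 < e n - (d (x n) (x n.+1) + e n.+1) by rewrite subr_gt0.
    have [m [nm _ mz]] := lim _ gap n.+1.
    have := far n.+1 (m - n.+1)%N; rewrite subnK// => h.
    have := tri (x n) (x m) z; have := tri (x n) (x n.+1) (x m).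
    by have := e0 m; lra.
  have [c c0 cO] := (cd O).1 oO _ Oz.
  have c20 : 0 < c / 2 by lra.
  have [N Nc] := esmall _ c20.
  have [n [Nn zn _]] := lim _ c20 N.
  have := efar N (n - N)%N; rewrite subnK// => h.
  exists n => y /=; rewrite -/(x n) -/(e n) => ny; apply: cO => /=.
  by have := tri z (x n) y; lra.
Qed.

Lemma sieve_complete_prod (T1 T2 : topologicalType) :
  sieve_complete T1 -> sieve_complete T2 -> sieve_complete (T1 * T2)%type.
Proof.
move=> [J1 [U1 [r1 S1]]] [J2 [U2 [r2 S2]]].
case: (S1) => o1 m1 c1 b1 l1; case: (S2) => o2 m2 c2 b2 l2.
exists (J1 * J2)%type, (fun p => U1 p.1 `*` U2 p.2),
  (fun p q => r1 p.1 q.1 /\ r2 p.2 q.2); split.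
- move=> [i j] /=; rewrite openE => -[x y] [/= ix jy].
  by exists (U1 i, U2 j) => //=; split; exact: open_nbhs_nbhs.
- by move=> [i j] [k l] /= [/m1 h1 /m2 h2] [x y] [/h1 ? /h2 ?].
- by move=> [x y]; have [i ix] := c1 x; have [j jy] := c2 y; exists (i, j).
- move=> [i j] [x y] O [/= ix jy] oO Oxy.
  have : nbhs (x, y) O by exact: open_nbhs_nbhs.
  move=> [[A B] [/= /nbhs_interior nA /nbhs_interior nB] ABO].
  have [k [ik kx kA]] := b1 i x _ ix (open_interior A) (nbhs_singleton nA).
  have [l [jl ly lB]] := b2 j y _ jy (open_interior B) (nbhs_singleton nB).
  exists (k, l); split=> //= -[a b] [/= /kA/interior_subset Aa /lB/interior_subset Bb].
  exact: (ABO (a, b)).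
- move=> s sr.
  have [x [xs xl]] := l1 (fun n => (s n).1) (fun n => (sr n).1).
  have [y [ys yl]] := l2 (fun n => (s n).2) (fun n => (sr n).2).
  exists (x, y); split=> [n|O oO Oxy]; first by split.
  have : nbhs (x, y) O by exact: open_nbhs_nbhs.
  move=> [[A B] [/= /nbhs_interior nA /nbhs_interior nB] ABO].
  have [m mA] := xl _ (open_interior A) (nbhs_singleton nA).
  have [n nB'] := yl _ (open_interior B) (nbhs_singleton nB).
  exists (maxn m n) => -[a b] [/= am bn]; apply: (ABO (a, b)); split => /=.
    apply: interior_subset; apply: mA.
    exact: (sieve_chain_subset (s := fun n => (s n).1) S1 (fun n => (sr n).1) (leq_maxl m n)).
  apply: interior_subset; apply: nB'.
  exact: (sieve_chain_subset (s := fun n => (s n).2) S2 (fun n => (sr n).2) (leq_maxr m n)).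
Qed.

(** [Y] is a Pi^0_2 set on which [f] is open and continuous. A move is the image of a set of the
    sieve, with a counter [n]; the next move must enter [P k] for every k < n such that the present
    set already lies in [W k]. If a limit is in [W k], so are the sets of the chain from some move
    on, and the limit is in [P k]. *)
Lemma sieve_complete_image (T Z : topologicalType) (W P : nat -> set T)
    (f : T -> Z) (Y := [set y | forall k, W k y -> P k y]) :
  sieve_complete T -> (forall k, open (P k)) -> (forall k, open (W k)) ->
  (forall z, exists2 y, Y y & f y = z) ->
  (forall O, open O -> open (f @` (O `&` Y))) ->
  (forall O y, open O -> Y y -> O (f y) ->
    exists2 N, open N & N y /\ forall y', N y' -> Y y' -> O (f y')) ->
  sieve_complete Z.
Proof.
move=> [J [U [r S]]] Po Wo fY fo fc; case: (S) => o mono c b l.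
exists (J * nat)%type, (fun p => f @` (U p.1 `&` Y)), (fun p q =>
  [/\ r p.1 q.1, (q.2 = p.2.+1) &
    forall k, (k < p.2)%N -> U p.1 `<=` W k -> U q.1 `<=` P k]).
split.
- by move=> [j n]; exact: fo.
- by move=> [j n] [k p] /= [/mono kj _ _] _ [y [/kj jy Yy] <-]; exists y.
- by move=> z; have [y Yy <-] := fY z; have [j jy] := c y; exists (j, 0%N), y.
- move=> [j n] _ O /= [y [jy Yy] <-] oO Oy.
  have [N oN [Ny NO]] := fc _ _ oO Yy Oy.
  have [M [oM My MP]] : exists M, [/\ open M, M y &
      forall k, (k < n)%N -> U j `<=` W k -> M `<=` P k].
    elim: n => [|n [M [oM My MP]]]; first by exists setT; split=> //; exact: openT.
    have [jW|njW] := pselect (U j `<=` W n).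
      exists (M `&` P n); split; [exact: openI|by split=> //; apply/Yy/jW|].
      move=> k; rewrite ltnS leq_eqVlt => /predU1P[-> _|kn kW]; first by move=> ? [].
      by move=> y' [My' _]; exact: MP kn kW _ My'.
    exists M; split=> // k; rewrite ltnS leq_eqVlt => /predU1P[->//|]; exact: MP.
  have [k [jk ky kNM]] := b _ _ _ jy (openI oN oM) (conj Ny My).
  exists (k, n.+1); split=> /=.
  + by split=> // i ik ji; apply: subset_trans (MP i ik ji) => y' /kNM[].
  + by exists y.
  + by move=> _ [y' [/kNM[Ny' _] Yy'] <-]; exact: NO.
- move=> s sr; have sr1 n : r (s n).1 (s n.+1).1 by case: (sr n).
  have s2 n : ((s n).2 = n + (s 0%N).2)%N.
    by elim: n => [//|n IH]; have [_ -> _] := sr n; rewrite IH addSn.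
  have [y [ys yl]] := l _ sr1.
  have Yy : Y y.
    move=> k Wky; have [n nW] := yl _ (Wo k) Wky.
    (* From index [n] on the sets lie in [W k], and from [k.+1] on the counter exceeds [k]. *)
    have [_ _ h] := sr (maxn n k.+1).
    apply: h (ys (maxn n k.+1).+1).
      by rewrite s2; apply: leq_trans (leq_maxr n k.+1) (leq_addr _ _).
    by apply: subset_trans nW; exact: (sieve_chain_subset S sr1 (leq_maxl n k.+1)).
  exists (f y); split=> [n|O oO Oy]; first by exists y.
  have [N oN [Ny NO]] := fc _ _ oO Yy Oy.
  have [n nN] := yl _ oN Ny.
  by exists n => _ [y' [/nN Ny' Yy'] <-]; exact: NO.
Qed.

(** * Complete metrics from continuous functions *)

Section WeightedSup.
Context {R : realType}.
Implicit Types a b : nat -> R.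

(** Distance from zero in a countable product of lines: with coordinate n truncated at 2^-n, only
    finitely many coordinates matter at a given scale. *)
Definition wsup a : R := sup (range (fun n => Num.min (2 ^- n) `|a n|)).

Lemma expV2_gt0 n : 0 < (2 ^- n : R).
Proof. by rewrite invr_gt0 exprn_gt0. Qed.

Lemma expV2_anti m n : (m <= n)%N -> (2 ^- n : R) <= 2 ^- m.
Proof. by move=> mn; rewrite lef_pV2 ?posrE ?exprn_gt0// ler_eXn2l// ltr1n. Qed.

Lemma expV2_small (e : R) : 0 < e -> exists n, (2 ^- n : R) < e.
Proof.
move=> e0; exists (Num.bound e^-1).
rewrite invf_plt ?posrE ?exprn_gt0//.
have := @archi_boundP R e^-1; rewrite invr_ge0 ltW// => /(_ isT) h.
by apply: lt_trans h _; rewrite -natrX ltr_nat; exact: ltn_expl.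
Qed.

Lemma wsup_le a c : (forall n, Num.min (2 ^- n) `|a n| <= c) -> wsup a <= c.
Proof.
by move=> h; apply: ge_sup => [|_ [n _ <-]//]; exists (Num.min (2 ^- 0) `|a 0%N|), 0%N.
Qed.

Lemma le_wsup a n : Num.min (2 ^- n) `|a n| <= wsup a.
Proof.
apply: ub_le_sup; last by exists n.
exists 1 => _ [m _ <-]; rewrite ge_min; apply/orP; left.
by have := expV2_anti (leq0n m); rewrite expr0 invr1.
Qed.

Lemma wsup_ge0 a : 0 <= wsup a.
Proof. by apply: le_trans (le_wsup a 0); rewrite le_min normr_ge0 ltW// expV2_gt0. Qed.

Lemma wsup_gt0 a n : a n != 0 -> 0 < wsup a.
Proof. by move=> an; apply: lt_le_trans (le_wsup a n); rewrite lt_min expV2_gt0 normr_gt0. Qed.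

Lemma wsup_gt a c : 0 <= c -> c < wsup a ->
  exists n, c < (2 ^- n : R) /\ c < `|a n|.
Proof.
move=> c0 ca; apply: contrapT => h.
suff : wsup a <= c by rewrite leNgt ca.
apply: wsup_le => n; rewrite leNgt; apply/negP; rewrite lt_min => /andP[? ?].
by apply: h; exists n.
Qed.

Lemma minr_add (w a b c : R) : 0 <= w -> 0 <= b -> 0 <= c -> a <= b + c ->
  Num.min w a <= Num.min w b + Num.min w c.
Proof.
move=> w0 b0 c0 abc; rewrite [Num.min w b]minEle [Num.min w c]minEle.
by case: ifPn; case: ifPn => ? ?; rewrite ge_min; apply/orP;
  do ?[left; lra|right; lra].
Qed.

Lemma minr_lt (w a b : R) : Num.min w a < Num.min w b -> a < b.
Proof.
rewrite lt_min gt_min ltxx /= => /andP[aw].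
by rewrite gt_min => /orP[wb|//]; exact: lt_trans aw wb.
Qed.

Lemma wsup_add a b c : (forall n, `|a n| <= `|b n| + `|c n|) ->
  wsup a <= wsup b + wsup c.
Proof.
move=> h; apply: wsup_le => n.
apply: le_trans (minr_add (ltW (expV2_gt0 n)) _ _ (h n)) _ => //.
by apply: lerD; exact: le_wsup.
Qed.

Lemma continuous_wsup (T : topologicalType) (F : nat -> T -> R) :
  (forall n, continuous (F n)) -> continuous (fun x => wsup (F^~ x)).
Proof.
move=> cF x; apply/cvgrPdist_le => e e0.
have [N Ne] := expV2_small e0.
have : \forall y \near x, forall n, (n < N)%N -> `|F n x - F n y| <= e.
  elim: N {Ne} => [|N IH]; first by near=> y.
  have cN : \forall y \near x, `|F N x - F N y| <= e.
    by move/cvgrPdist_le: (cF N x); apply.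
  near=> y => n; rewrite ltnS leq_eqVlt => /predU1P[->|nN].
    by near: y.
  by move: n nN; near: y.
apply: filterS => y Fxy.
have half u v : (forall n, (n < N)%N -> `|F n u - F n v| <= e) ->
    wsup (F^~ u) <= wsup (F^~ v) + e.
  move=> Fuv; apply: wsup_le => n; have [nN|Nn] := ltnP n N; last first.
    rewrite ge_min; apply/orP; left.
    have := expV2_anti Nn; have := wsup_ge0 (F^~ v); lra.
  have le1 : `|F n u| <= `|F n v| + e.
    have := Fuv n nN; have := ler_normD (F n v) (F n u - F n v).
    by rewrite [F n v + _]addrC subrK; lra.
  apply: le_trans (minr_add (ltW (expV2_gt0 n)) _ (ltW e0) le1) _ => //.
  by apply: lerD (le_wsup _ n) _; rewrite ge_min lexx orbT.
rewrite ler_norml; have := half x y Fxy.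
have : wsup (F^~ y) <= wsup (F^~ x) + e.
  by apply: half => n nN; rewrite distrC; exact: Fxy.
by lra.
Unshelve. all: by end_near. Qed.

End WeightedSup.

Section CompleteMetric.
Context {R : realType} {T : topologicalType}.
Variables (f : nat -> T -> R) (r : nat -> nat -> Prop).
Hypothesis f_cts : forall n, continuous (f n).
Hypothesis f_ge0 : forall n x, 0 <= f n x.
Hypothesis f_cover : forall x, exists n, 0 < f n x.
Hypothesis f_refine : forall n x, 0 < f n x -> exists2 m, r n m & 0 < f m x.
Hypothesis f_chain : forall s : nat -> nat, (forall n, r (s n) (s n.+1)) ->
  exists x, forall O, open O -> O x -> exists n, [set y | 0 < f (s n) y] `<=` O.
Hypothesis f_basis : forall x O, open O -> O x ->
  exists2 n, 0 < f n x & [set y | 0 < f n y] `<=` O.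
Hypothesis f_inj : forall x y, (forall n, f n x = f n y) -> x = y.

(* The stage None stands for the root of the tree of indices. *)
Let stage (i : option nat) (x : T) : R := if i is Some n then f n x else 1.
Let next (i : option nat) m := if i is Some n then r n m else True.
Let child i m (x : T) : R := if `[< next i m >] then f m x else 0.

(* Vanishes only where stage i is at least 1 / k.+1 but no child of i is positive,
   that is nowhere; its inverse keeps Cauchy sequences away from such ideal
   points. *)
Let gap (p : option nat * nat) (x : T) : R :=
  `|p.2.+1%:R^-1 - stage p.1 x| + (p.2.+1%:R^-1 - stage p.1 x)
    + wsup (child p.1 ^~ x).

(** Coordinates of an embedding in a countable product of lines: the [f m] determine the topology,
    the inverses of the gaps yield completeness. *)
Let coord (n : nat) (x : T) : R :=
  match unpickle n with
  | Some (inl m) => f m x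
  | Some (inr p) => (gap p x)^-1
  | None => 0
  end.

Let dist (x y : T) : R := wsup (fun n => coord n x - coord n y).

Let stage_child i x : 0 < stage i x -> exists2 m, next i m & 0 < f m x.
Proof.
case: i => [n|_] /=; first exact: f_refine.
by have [m mx] := f_cover x; exists m.
Qed.

Let gap_gt0 p x : 0 < gap p x.
Proof.
rewrite /gap; set a := _ - _.
have aN : 0 <= `|a| + a by have := ler_norm (- a); rewrite normrN; lra.
have [x0|x0] := ltP 0 (stage p.1 x).
  have [m im mx] := stage_child x0.
  suff : 0 < wsup (child p.1 ^~ x) by lra.
  by apply: (@wsup_gt0 _ _ m); rewrite /child asboolT//; rewrite gt_eqF.
have a0 : 0 < a.
  by rewrite subr_gt0; apply: le_lt_trans x0 _; rewrite invr_gt0 ltr0n.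
by have := wsup_ge0 (child p.1 ^~ x); rewrite gtr0_norm//; lra.
Qed.

Let coord_cts n : continuous (coord n).
Proof.
rewrite /coord; case: unpickle => [[m|[i k]]|]; first exact: f_cts.
  move=> x; apply: cvgV; first by rewrite gt_eqF// gap_gt0.
  have cs : continuous (stage i).
    by case: i => [m|] /=; [exact: f_cts|move=> y; exact: cvg_cst].
  have cb : {for x, continuous (fun y => k.+1%:R^-1 - stage i y)}.
    by apply: cvgB; [exact: cvg_cst|exact: cs].
  rewrite /gap /=; apply: cvgD; first by apply: cvgD => //; exact: cvg_norm.
  apply: continuous_wsup => m y; rewrite /child.
  by case: asboolP => _; [exact: f_cts|exact: cvg_cst].
by move=> x; exact: cvg_cst.
Qed.

Let dist_cts x : continuous (dist x).
Proof.
apply: continuous_wsup => n y; apply: cvgB; first exact: cvg_cst.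
exact: coord_cts.
Qed.

Let dist_sym x y : dist x y = dist y x.
Proof.
by rewrite /dist /wsup; under eq_fun do rewrite distrC.
Qed.

Let distxx x : dist x x = 0.
Proof.
apply/eqP; rewrite eq_le wsup_ge0 andbT; apply: wsup_le => n.
by rewrite subrr normr0 ge_min lexx orbT.
Qed.

Let dist_metric : metric dist.
Proof.
split; last exact: dist_sym.
split=> [x y|x y|x y z]; first exact: wsup_ge0.
  split=> [->|[dxy _]]; first by rewrite distxx.
  apply: f_inj => m; apply/eqP; rewrite -subr_eq0; apply/negP => /negP ne.
  have := @wsup_gt0 _ (fun n => coord n x - coord n y) (pickle (inl m : nat + option nat * nat)%type).
  by rewrite /coord pickleK => /(_ ne); rewrite -/(dist x y) dxy ltxx.
apply: wsup_add => n; rewrite -[in leLHS](subrK (coord n y) (coord n x)) -addrA; exact: ler_normD.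
Qed.

Let ball_open x (e : R) : open [set y | dist x y < e].
Proof.
apply: (@open_comp _ _ (dist x) [set z | z < e]); last exact: open_lt.
by move=> y _; exact: dist_cts.
Qed.

Let dist_compatible : compatible dist.
Proof.
move=> U; split=> [oU x Ux|hU]; last first.
  rewrite openE => x Ux; have [e e0 eU] := hU x Ux.
  apply: filterS eU _; apply: open_nbhs_nbhs; split; first exact: ball_open.
  by rewrite /= distxx.
have [m mx mU] := f_basis oU Ux.
pose k := pickle (inl m : nat + option nat * nat)%type.
exists (Num.min (2 ^- k) (f m x)); first by rewrite lt_min expV2_gt0.
move=> y /= dxy; apply: mU => /=.
have := le_lt_trans (le_wsup _ k) dxy => /minr_lt.
by rewrite /coord pickleK ltr_norml; lra.
Qed.

Section Cauchy.
Variable u : nat -> T.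
Hypothesis u_cauchy : quasi_cauchy dist u.

Let coord_cauchy n (e : R) : 0 < e -> exists K, forall k l, (K <= k)%N -> (k <= l)%N ->
  `|coord n (u k) - coord n (u l)| < e.
Proof.
move=> e0; have [|K KP] := u_cauchy (e := Num.min (2 ^- n) e).
  by rewrite lt_min expV2_gt0.
exists K => k l Kk kl; have := KP k l Kk kl => /(le_lt_trans (le_wsup _ n)).
exact: minr_lt.
Qed.

Let f_cauchy m (e : R) : 0 < e -> exists K, forall k l, (K <= k)%N -> (k <= l)%N ->
  `|f m (u k) - f m (u l)| < e.
Proof.
move=> /(coord_cauchy (pickle (inl m : nat + option nat * nat)%type)).
by rewrite /coord pickleK.
Qed.

Let f_cauchy_below N (e : R) : 0 < e -> exists K, forall m k l, (m < N)%N ->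
  (K <= k)%N -> (k <= l)%N -> `|f m (u k) - f m (u l)| < e.
Proof.
move=> e0; elim: N => [|N [K KP]]; first by exists 0%N.
have [L LP] := f_cauchy N e0.
exists (maxn K L) => m k l; rewrite ltnS geq_max => mN /andP[Kk Lk] kl.
by move: mN; rewrite leq_eqVlt => /predU1P[->|mN]; [exact: LP|exact: KP].
Qed.

Let eventually_pos i := exists2 e : R, 0 < e &
  exists K, forall k, (K <= k)%N -> e <= stage i (u k).

(** While stage [i] is at least 1/(q+1), the gap [(i, q)] reduces to the weighted supremum of the
    children. Its inverse is a coordinate, hence bounded along the Cauchy sequence, so the supremum
    stays above a positive constant. Only finitely many children can account for this, and one of
    them remains positive. *)
Let eventually_pos_child i : eventually_pos i ->
  exists m, next i m /\ eventually_pos (Some m).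
Proof.
move=> [e e0 [K KP]]; pose q := Num.bound e^-1.
have qe : q.+1%:R^-1 <= e.
  rewrite -[leRHS]invrK lef_pV2 ?posrE ?invr_gt0 ?ltr0n//.
  have := @archi_boundP R e^-1; rewrite invr_ge0 ltW// => /(_ isT)/ltW h.
  by apply: le_trans h _; rewrite ler_nat.
pose g k := wsup (child i ^~ (u k)).
have gapE k : (K <= k)%N -> gap (i, q) (u k) = g k.
  move=> /KP h; rewrite /gap /= ler0_norm; last by rewrite subr_le0 (le_trans qe).
  by rewrite addNr add0r.
have [L LP] := coord_cauchy (pickle (inr (i, q) : nat + option nat * nat)%type) ltr01.
(* From [k0] on the inverse gaps differ by less than 1 from their value at [k0], whence the bound
   [M]. *)
pose k0 := maxn K L; pose M := 1 + (g k0)^-1.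
have g0 k : (K <= k)%N -> 0 < g k by move=> Kk; rewrite -gapE// gap_gt0.
have M0 : 0 < M by rewrite addr_gt0// invr_gt0 g0// leq_maxl.
have gM k : (k0 <= k)%N -> M^-1 <= g k.
  move=> k0k; have Kk : (K <= k)%N by exact: leq_trans (leq_maxl _ _) k0k.
  rewrite -[leRHS]invrK lef_pV2 ?posrE ?invr_gt0 ?g0//.
  have := LP k0 k (leq_maxr _ _) k0k.
  rewrite /coord pickleK !gapE ?leq_maxl// ltr_norml /M.
  move: ((g k0)^-1) ((g k)^-1) => a b /andP[ab _].
  by rewrite -lerBlDr -opprB lerNl ltW.
pose c := M^-1 / 2; have c0 : 0 < c by rewrite divr_gt0// invr_gt0.
have c20 : 0 < c / 2 by rewrite divr_gt0.
(* A child that exceeds [c] in the truncated supremum has index below [N]; on these children the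
   sequence moves by less than [c / 2] after [L']. *)
have [N Nc] := expV2_small c0.
have [L' L'P] := f_cauchy_below N c20.
pose k1 := maxn k0 L'.
have [||m [mc]] := @wsup_gt _ (child i ^~ (u k1)) c; first exact: ltW.
  apply: lt_le_trans (gM k1 (leq_maxl _ _)).
  by rewrite /c ltr_pdivrMr// ltr_pMr ?invr_gt0// ltr1n.
rewrite /child; case: asboolP => [im|_]; last by rewrite normr0 ltNge ltW.
rewrite ger0_norm// => cm; exists m; split=> //; exists (c / 2) => //; exists k1.
move=> k k1k.
have mN : (m < N)%N.
  rewrite ltnNge; apply/negP => /(@expV2_anti R); lra.
have := L'P m k1 k mN (leq_maxr _ _) k1k; rewrite ltr_norml /=; lra.
Qed.

(** From the root on, each eventually positive index has an eventually positive child. The resulting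
    chain converges to a point, and each positivity set along it contains a tail of [u]. *)
Lemma complete_dist : exists x, forall e : R, 0 < e ->
  exists N : nat, forall n : nat, (N <= n)%N ->
    Num.max (dist x (u n)) (dist (u n) x) < e.
Proof.
have [m0 [_ m0P]] : exists m, next None m /\ eventually_pos (Some m).
  by apply: eventually_pos_child; exists 1 => //; exists 0%N => k _ /=.
have [s _ sP] := @dependent_choice_on nat (fun _ m => eventually_pos (Some m))
  (fun _ m n => r m n) m0 m0P (fun _ m => @eventually_pos_child (Some m)).
have [x xP] := f_chain (fun n => (sP n).2).
exists x => e e0; have [|n nO] := xP _ (@ball_open x e); first by rewrite /= distxx.
have [[d d0 [K KP]] _] := sP n.
exists K => k Kk; rewrite [dist (u k) x]dist_sym maxxx.
by apply: nO => /=; exact: lt_le_trans d0 (KP k Kk).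
Qed.

End Cauchy.

Lemma exists_complete_metric : exists d : T -> T -> R,
  [/\ metric d, compatible d & quasi_complete d].
Proof. by exists dist; split=> //; exact: complete_dist. Qed.

End CompleteMetric.

(** * Metrization of regular spaces with a complete sieve *)

Lemma open_below (T : topologicalType) (F : nat -> set T) n :
  (forall k, (k < n)%N -> open (F k)) ->
  open [set x | forall k, (k < n)%N -> F k x].
Proof.
elim: n => [_|n IH oF].
  by rewrite (_ : [set _ | _] = setT); [exact: openT|apply/seteqP].
rewrite (_ : [set _ | _] = [set x | forall k, (k < n)%N -> F k x] `&` F n).
  by apply: openI; [apply: IH => k kn; apply: oF; rewrite ltnS ltnW|exact: oF].
apply/seteqP; split=> [x h|x [h hn] k].
  by split=> [k kn|]; apply: h; rewrite ltnS// ltnW.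
by rewrite ltnS leq_eqVlt => /predU1P[->|]; [|exact: h].
Qed.

Lemma regular_basis_closure (T : topologicalType) (b : nat -> set T) :
  regular_space T ->
  (forall x O, open O -> O x -> exists n, b n x /\ b n `<=` O) ->
  forall x O, open O -> O x -> exists n, b n x /\ closure (b n) `<=` O.
Proof.
move=> reg bb x O oO Ox; have [|V nV VO] := reg x O; first exact: open_nbhs_nbhs.
have [n [nx nV']] := bb x _ (open_interior V) nV.
exists n; split=> //; apply: subset_trans VO; apply: closureS.
by apply: subset_trans nV' _; exact: interior_subset.
Qed.

(** Tychonoff's argument: each of the two closed sets is covered by countably many basic sets whose
    closures miss the other one; from each set of one cover the closures of the earlier sets of the
    other cover are removed. *)
Lemma regular_second_countable_normal (R : realType) (T : topologicalType) :
  regular_space T -> @second_countable T -> normal_space T.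
Proof.
move=> reg /second_countable_enum[b [bo bb]].
have bc := regular_basis_closure reg bb.
apply/(@normal_openP R) => A B cA cB AB0.
pose a (C : set T) n := if `[< closure (b n) `<=` ~` C >] then b n else set0.
have ao C n : open (a C n) by rewrite /a; case: ifP => _; [exact: bo|exact: open0].
have aC C n : closure (a C n) `<=` ~` C.
  by rewrite /a; case: asboolP => // _; rewrite closure0.
have aD C D x : closed C -> C `&` D = set0 -> D x -> exists n, a C n x.
  move=> cC CD Dx; have [|n [nx nC]] := bc x _ (closed_openC cC).
    by move=> Cx; have : (C `&` D) x by []; rewrite CD.
  by exists n; rewrite /a asboolT.
(* The bound [n.+1] also removes the closure with the same index, so that sets of equal index are
   disjoint too. *)
pose S C D n := a C n `&` [set x | forall k, (k < n.+1)%N -> (~` closure (a D k)) x].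
have So C D : open (\bigcup_n S C D n).
  apply: bigcup_open => n _; apply: openI => //; apply: open_below => k _.
  exact/closed_openC/closed_closure.
exists (\bigcup_n S B A n), (\bigcup_n S A B n); split=> //.
- move=> x Ax; have [n nx] : exists n, a B n x by apply: (aD B A) => //; rewrite setIC.
  by exists n => //; split=> // k _ /aC.
- move=> x Bx; have [n nx] : exists n, a A n x by exact: (aD A B).
  by exists n => //; split=> // k _ /aC.
- apply/seteqP; split=> // x [[m _ [am mP]] [n _ [an nP]]].
  have [mn|nm] := leqP m n.
    by apply: nP mn _; exact: subset_closure.
  by apply: mP (ltnW nm) _; exact: subset_closure.
Qed.

(** An open set is the union of the basic sets whose closures it contains; the Urysohn functions of
    these closures are combined by the weighted supremum. *)
Lemma open_cozero (R : realType) (T : topologicalType) (O : set T) :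
  regular_space T -> @second_countable T -> open O ->
  exists f : T -> R, [/\ continuous f, forall x, 0 <= f x &
    forall x, O x <-> 0 < f x].
Proof.
move=> reg sc oO; have nT := regular_second_countable_normal R reg sc.
have [b [bo bb]] := second_countable_enum sc.
have bc := regular_basis_closure reg bb.
have /choice[g gP] : forall n : nat, exists g : T -> R, [/\ continuous g,
    forall x, ~ O x -> g x = 0 &
    closure (b n) `<=` O -> forall x, b n x -> g x = 1].
  move=> n; have [nO|nO] := pselect (closure (b n) `<=` O); last first.
    by exists (fun=> 0); split=> // x; exact: cvg_cst.
  have : uniform_separator (~` O) (closure (b n)).
    apply: normal_uniform_separator => //; first exact: open_closedC.
      exact: closed_closure.
    by apply/seteqP; split=> // x [] ? /nO.
  move=> /(@uniform_separatorP _ R)[h [ch _ h0 h1]]; exists h; split=> // [x Ox|_ x nx].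
    by apply: h0; exists x.
  by apply: h1; exists x => //; exact: subset_closure.
exists (fun x => wsup (g^~ x)); split.
- by apply: continuous_wsup => n; case: (gP n).
- by move=> x; exact: wsup_ge0.
- move=> x; split=> [Ox|]; last first.
    apply: contraPP => Ox; apply/negP; rewrite -leNgt; apply: wsup_le => n.
    by have [_ -> // _] := gP n; rewrite normr0 ge_min lexx orbT.
  have [n [nx nO]] := bc x O oO Ox.
  by apply: (@wsup_gt0 _ _ n); have [_ _ ->] := gP n; rewrite // oner_neq0.
Qed.

(** Refinements are chosen once for every index and basic open set instead of every point; only
    countably many indices are reached from the starting ones by finite words of such choices. *)
Lemma sieve_countable (T : topologicalType) (J : Type) (U : J -> set T)
    (r : J -> J -> Prop) : sieve U r -> @second_countable T -> [set: T] !=set0 ->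
  exists e : nat -> J, (forall x, exists n, U (e n) x) /\
    forall n x, U (e n) x -> exists m, r (e n) (e m) /\ U (e m) x.
Proof.
move=> [Uo _ cov ref _] /second_countable_enum[b [bo bb]] [x0 _].
have [j0 _] := cov x0.
have pick (P : J -> Prop) : exists k : nat -> J,
    forall n, (exists j, P j /\ b n `<=` U j) -> P (k n) /\ b n `<=` U (k n).
  have /choice[k kP] : forall n : nat, exists j,
      (exists j, P j /\ b n `<=` U j) -> P j /\ b n `<=` U j.
    move=> n; have [[j jP]|nj] := pselect (exists j, P j /\ b n `<=` U j).
      by exists j.
    by exists j0.
  by exists k.
have [start startP] := pick (fun=> True).
have /choice[sel selP] := fun j => pick (r j).
pose jj (p : nat * seq nat) := foldr (fun m j => sel j m) (start p.1) p.2.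
pose e n := if unpickle n is Some p then jj p else jj (0%N, [::]).
have ej n : exists p, e n = jj p.
  by rewrite /e; case: unpickle => [p|]; [exists p|exists (0%N, [::])].
have je p : exists n, e n = jj p by exists (pickle p); rewrite /e pickleK.
exists e; split=> [x|n x].
  have [j jx] := cov x; have [n [nx nj]] := bb _ _ (Uo j) jx.
  have [|_ h] := startP n; first by exists j.
  by have [m mE] := je (n, [::]); exists m; rewrite mE; exact: h.
have [[a p] ->] := ej n => jx.
have [k [jk kx _]] := ref _ x setT jx openT I.
have [m [mx mk]] := bb _ _ (Uo k) kx.
have [|rm h] := selP (jj (a, p)) m; first by exists k.
have [i iE] := je (a, m :: p); exists i; rewrite iE; split=> //.
exact: h.
Qed.

Lemma sieve_complete_polish (R : realType) (T : topologicalType) :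
  sieve_complete T -> @second_countable T -> regular_space T ->
  (forall x y : T, (forall O, open O -> O x -> O y) -> x = y) ->
  polish R T.
Proof.
move=> [J [U [r S]]] sc reg t1; split=> //.
have [ne|e0] := pselect ([set: T] !=set0); last first.
  (* On the empty space any distance will do. *)
  have F (x : T) : False by apply: e0; exists x.
  exists (fun _ _ => 0); split=> [|V|u _]; last by case: (F (u 0%N)).
    by split=> [|x]; [split=> x; case: (F x)|case: (F x)].
  by split=> [_ x|_]; [case: (F x)|rewrite openE => x; case: (F x)].
have [e [ecov eref]] := sieve_countable S sc ne.
case: (S) => Uo _ _ _ lim.
have /choice[f fP] := fun n : nat => @open_cozero R T _ reg sc (Uo (e n)).
have fU n x : U (e n) x <-> 0 < f n x by have [_ _ ->] := fP n.
(* A chain of sets containing [x] converges to a point [x'] all of whose neighbourhoods contain [x].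
   By [t1] the two points agree, so the sets of the chain form a neighbourhood basis at [x]. *)
have fbasis x O : open O -> O x ->
    exists2 n, 0 < f n x & [set y | 0 < f n y] `<=` O.
  move=> oO Ox; have [n0 n0x] := ecov x.
  have [|s _ sP] := @dependent_choice_on nat (fun _ n => U (e n) x)
    (fun _ m n => r (e m) (e n)) n0 n0x.
    by move=> _ n /eref[m [? ?]]; exists m.
  have [x' [_ x'l]] := lim _ (fun n => (sP n).2).
  have x'x : x' = x.
    by apply: t1 => V oV /(x'l V oV)[n]; apply; exact: (sP n).1.
  rewrite x'x in x'l; have [n nO] := x'l O oO Ox.
  exists (s n); first by apply/fU; exact: (sP n).1.
  by move=> y /= /fU /nO.
apply: (@exists_complete_metric R T f (fun m n => r (e m) (e n))) => //.
- by move=> n; case: (fP n).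
- by move=> n; case: (fP n).
- by move=> x; have [n /fU nx] := ecov x; exists n.
- by move=> n x /fU/eref[m [rm /fU mx]]; exists m.
- move=> s /lim[x [_ xl]]; exists x => O oO /(xl O oO)[n nO].
  by exists n => y /= /fU/nO.
- move=> x y fxy; apply: t1 => O oO Ox; have [n nx nO] := fbasis x O oO Ox.
  by apply: nO; rewrite /= -fxy.
Qed.

Lemma regular_T0_T1 (T : topologicalType) : regular_space T ->
  (forall x y : T, (forall O, open O -> O x <-> O y) -> x = y) ->
  forall x y : T, (forall O, open O -> O x -> O y) -> x = y.
Proof.
move=> reg t0 x y xy; apply: t0 => O oO; split; first exact: xy.
move=> Oy; apply: contrapT => nOx.
have [|V nV VO] := reg y O; first exact: open_nbhs_nbhs.
have : (~` closure V) y.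
  by apply: xy; [exact/closed_openC/closed_closure|move=> /VO].
by apply; apply: subset_closure; exact: nbhs_singleton.
Qed.

(** * Baire category and the Borel hierarchy *)

Section Meager.
Context {T : topologicalType}.
Implicit Types A B O S U V : set T.

Lemma nowhere_denseP A : nowhere_dense A <->
  forall O, open O -> O !=set0 ->
    exists O', [/\ open O', O' !=set0, O' `<=` O & O' `<=` ~` A].
Proof.
split=> [A0 O oO [x Ox]|h].
  have [OA|] := pselect (O `<=` closure A).
    have : (closure A)° x.
      by apply: filterS OA _; exact: open_nbhs_nbhs.
    by rewrite A0.
  move=> /existsNP[y /not_implyP[Oy cy]].
  exists (O `&` ~` closure A); split.
  - by apply: openI => //; exact/closed_openC/closed_closure.
  - by exists y.
  - by move=> ? [].
  - by move=> z [_ cz] Az; apply: cz; exact: subset_closure.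
apply/seteqP; split=> // x xA.
have [|O' [oO' [y O'y] O'A O'nA]] := h _ (open_interior (closure A)).
  by exists x.
have /interior_subset cy := O'A y O'y.
have [|z [Az O'z]] := cy O'; first exact: open_nbhs_nbhs.
exact: O'nA O'z Az.
Qed.

Lemma nowhere_dense_meager A : nowhere_dense A -> meager A.
Proof. by move=> A0; exists (fun=> A) => // x Ax; exists 0%N. Qed.

Lemma meagerS A B : A `<=` B -> meager B -> meager A.
Proof. by move=> AB [F F0 BF]; exists F => //; exact: subset_trans AB BF. Qed.

Lemma meager_bigcup (A : nat -> set T) :
  (forall n, meager (A n)) -> meager (\bigcup_n A n).
Proof.
move=> mA; have /choice[F FP] : forall n, exists F : nat -> set T,
    (forall m, nowhere_dense (F m)) /\ A n `<=` \bigcup_m F m.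
  by move=> n; have [F F0 AF] := mA n; exists F.
have nd0 : nowhere_dense (set0 : set T).
  by apply/nowhere_denseP => O oO On; exists O; split=> // ? ? [].
exists (fun k => if unpickle k is Some p then F p.1 p.2 else set0).
  by move=> k; case: unpickle => // p; exact: (FP p.1).1.
move=> x [n _ /(FP n).2[m _ Fx]]; exists (pickle (n, m)) => //.
by rewrite pickleK.
Qed.

Lemma meager0 : meager (set0 : set T).
Proof.
apply: nowhere_dense_meager; apply/nowhere_denseP => O oO On.
by exists O; split=> // ? ? [].
Qed.

Lemma meagerU A B : meager A -> meager B -> meager (A `|` B).
Proof.
move=> mA mB; apply: (@meagerS _ (\bigcup_n (if n is 0%N then A else B))).
  by move=> x [Ax|Bx]; [exists 0%N|exists 1%N].
by apply: meager_bigcup => -[|n].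
Qed.

Lemma meager_bigcup_count (K : countType) (A : K -> set T) :
  (forall k, meager (A k)) -> meager (\bigcup_k A k).
Proof.
move=> mA; apply: (@meagerS _
  (\bigcup_n (if unpickle n is Some k then A k else set0))).
  by move=> x [k _ Ax]; exists (pickle k) => //; rewrite pickleK.
by apply: meager_bigcup => n; case: unpickle => // *; exact: meager0.
Qed.

Lemma meager_preimage (f g : T -> T) A : continuous f -> continuous g ->
  cancel f g -> cancel g f -> meager A -> meager (f @^-1` A).
Proof.
move=> /continuousP cf /continuousP cg fK gK [F F0 AF]; exists (fun n => f @^-1` F n); last first.
  by move=> x /AF[n _ Fx]; exists n.
move=> n; apply/nowhere_denseP => O oO [x Ox].
have /nowhere_denseP h := F0 n.
have [||O' [oO' [y O'y] O'O O'F]] := h (g @^-1` O).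
- exact: cg.
- by exists (f x); rewrite /= fK.
exists (f @^-1` O'); split.
- exact: cf.
- by exists (g y); rewrite /= gK.
- by move=> z /= /O'O /=; rewrite fK.
- by move=> z /= /O'F.
Qed.

(** The chain avoids the nowhere dense sets one at a time; its limit lies in all its sets, hence in
    none of the [F n]. *)
Lemma baire_category O : sieve_complete T -> open O -> O !=set0 -> ~ meager O.
Proof.
move=> [J [U [r [Uo _ cov ref lim]]]] oO [x0 Ox0] [F F0 OF].
have [j j0] := cov x0; have [k [_ kx kO]] := ref j x0 O j0 oO Ox0.
have [|s s0 sP] := @dependent_choice_on J (fun _ j => U j !=set0)
    (fun n i j => r i j /\ U j `<=` ~` F n) k (ex_intro _ x0 kx).
  move=> n i ix; have /nowhere_denseP h := F0 n.
  have [V [oV [y Vy] VU VF]] := h _ (Uo i) ix.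
  have [l [il ly lV]] := ref i y V (VU _ Vy) oV Vy.
  by exists l; do ?split=> //; [exact: subset_trans lV VF|exists y].
have [x [xs _]] := lim s (fun n => (sP n).2.1).
have [n _ Fx] : (\bigcup_n F n) x by apply/OF/kO; rewrite -s0.
exact: (sP n).2.2 (xs n.+1) Fx.
Qed.

(** A form of Banach's category theorem: countably many basic sets meet [S] in a meager set, and the
    part of [U] outside their union is nowhere dense. *)
Lemma locally_meager U S : @second_countable T -> open U ->
  (forall V, open V -> V !=set0 -> V `<=` U ->
    exists V', [/\ open V', V' !=set0, V' `<=` V & meager (V' `&` S)]) ->
  meager (U `&` S).
Proof.
move=> /second_countable_enum[b [bo bb]] oU h.
pose D := \bigcup_(n in [set n | meager (b n `&` S)]) b n.
apply: (@meagerS _ ((U `\` D) `|`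
    \bigcup_n (if `[< meager (b n `&` S) >] then b n `&` S else set0))).
  move=> x [Ux Sx]; have [[n nm nx]|nD] := pselect (D x); last by left.
  by right; exists n => //; rewrite asboolT.
apply: meagerU; last first.
  by apply: meager_bigcup => n; case: asboolP => // _; exact: meager0.
apply: nowhere_dense_meager; apply/nowhere_denseP => O oO On.
have [[x [Ox Ux]]|OU] := pselect ((O `&` U) !=set0); last first.
  by exists O; split=> // x Ox [Ux _]; apply: OU; exists x.
have [|||V' [oV' [y V'y] V'O mV']] := h (O `&` U); first exact: openI.
- by exists x.
- by move=> ? [].
have [n [ny nV']] := bb _ _ oV' V'y.
exists (b n); split=> //; first by exists y.
  by move=> z /nV'/V'O[].
move=> z nz [_]; apply; exists n => //=.
by apply: meagerS mV' => w [/nV' ? ?].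
Qed.

(* In a second countable space this is equivalent to S being equal to an open set
   up to a meager set. *)
Definition baire_property S := forall U, open U -> U !=set0 ->
  exists V, [/\ open V, V !=set0, V `<=` U &
    meager (V `&` S) \/ meager (V `\` S)].

Lemma baire_property_open S : open S -> baire_property S.
Proof.
move=> oS U oU Un; have [US|US] := pselect ((U `&` S) !=set0).
  exists (U `&` S); split=> //; [exact: openI|right].
  by apply: meagerS meager0 => x [[_ ?]].
exists U; split=> //; left; apply: meagerS meager0 => x USx.
by case: US; exists x.
Qed.

Lemma baire_propertyC S : baire_property S -> baire_property (~` S).
Proof.
move=> h U oU Un; have [V [oV Vn VU VS]] := h U oU Un.
exists V; split=> //; case: VS => mV; [right|left]; apply: meagerS mV => x [] //.
by move=> ? /contrapT.
Qed.

(** Either some [S n] is comeager in a nonempty open subset of [U], or every [S n] is locally meager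
    in [U] and hence meager there. *)
Lemma baire_property_bigcup (S : nat -> set T) : @second_countable T ->
  (forall n, baire_property (S n)) -> baire_property (\bigcup_n S n).
Proof.
move=> sc h U oU Un.
have [[n [V [oV Vn VU VS]]]|no] := pselect (exists n V,
    [/\ open V, V !=set0, V `<=` U & meager (V `\` S n)]).
  exists V; split=> //; right; apply: meagerS VS => x [Vx Sx].
  by split=> // Snx; apply: Sx; exists n.
exists U; split=> //; left; rewrite setI_bigcupr; apply: meager_bigcup => n.
apply: locally_meager => // V oV Vn VU.
have [V' [oV' V'n V'V [mV'|mV']]] := h n V oV Vn; first by exists V'.
by case: no; exists n, V'; split=> //; exact: subset_trans V'V VU.
Qed.

Lemma baire_propertyD A B : @second_countable T ->
  baire_property A -> baire_property B -> baire_property (A `\` B).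
Proof.
move=> sc bA bB; rewrite setDE -[A]setCK -setCU; apply: baire_propertyC.
rewrite (_ : _ `|` _ = \bigcup_n (if n is 0%N then ~` A else B)).
  by apply: baire_property_bigcup => // -[|n] //; exact: baire_propertyC.
apply/seteqP; split=> [x [Ax|Bx]|x [[|n] _]]; [by exists 0%N|by exists 1%N| |].
  by left.
by right.
Qed.

Lemma nonmeager_comeager U S : @second_countable T -> baire_property S ->
  open U -> ~ meager (U `&` S) ->
  exists V, [/\ open V, V !=set0, V `<=` U & meager (V `\` S)].
Proof.
move=> sc bS oU US; apply: contrapT => no; apply: US.
apply: locally_meager => // V oV Vn VU.
have [V' [oV' V'n V'V [mV'|mV']]] := bS V oV Vn; first by exists V'.
by case: no; exists V'; split=> //; exact: subset_trans V'V VU.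
Qed.

End Meager.

Section SigmaZero.
Context {d : Order.disp_t} {W : orderType d}.
Hypothesis wfW : well_ordered W.
Context {T : topologicalType}.
Implicit Types (xi zeta eta : W) (A B : set T).

Lemma Sigma0P xi A : Sigma0 xi A ->
  ((forall zeta, (xi <= zeta)%O) /\ open A) \/
  exists (zeta : nat -> W) (U V : nat -> set T), [/\ forall i, (zeta i < xi)%O,
    forall i, Sigma0 (zeta i) (U i), forall i, Sigma0 (zeta i) (V i) &
    A = \bigcup_i (U i `\` V i)].
Proof. by case=> [xi' U h oU|xi' zeta U V h hU hV]; [left|right; exists zeta, U, V]. Qed.

Lemma Sigma0_least xi A : (forall zeta, (xi <= zeta)%O) -> Sigma0 xi A -> open A.
Proof.
move=> least /Sigma0P[[]//|[zeta [U [V [lt _ _ _]]]]].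
by have := lt 0%N; rewrite ltNge least.
Qed.

Lemma Sigma0_bigcupP xi zeta A : (zeta < xi)%O -> Sigma0 xi A ->
  exists (zeta : nat -> W) (U V : nat -> set T), [/\ forall i, (zeta i < xi)%O,
    forall i, Sigma0 (zeta i) (U i), forall i, Sigma0 (zeta i) (V i) &
    A = \bigcup_i (U i `\` V i)].
Proof. by move=> lt /Sigma0P[[/(_ zeta)]|//]; rewrite leNgt lt. Qed.

Lemma least_or_lt xi : (forall zeta, (xi <= zeta)%O) \/ exists zeta, (zeta < xi)%O.
Proof.
have [[zeta lt]|no] := pselect (exists zeta, (zeta < xi)%O); first by right; exists zeta.
by left=> zeta; rewrite leNgt; apply/negP => lt; apply: no; exists zeta.
Qed.

Lemma exists_least xi : exists bot : W, forall zeta, (bot <= zeta)%O.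
Proof.
elim/(well_founded_ind wfW): xi => xi IH.
by have [least|[zeta /IH]] := least_or_lt xi; first by exists xi.
Qed.

Lemma open_Sigma0 xi A : open A -> Sigma0 xi A.
Proof.
move=> oA; have [bot botP] := exists_least xi.
have [least|[zeta lt]] := least_or_lt xi; first exact: Sigma0_open.
rewrite (_ : A = \bigcup_(i : nat) (A `\` set0)); last first.
  by apply/seteqP; split=> [x Ax|x [_ _ []//]]; exists 0%N => //; split.
apply: (Sigma0_bigcup (zeta := fun=> bot)) => i.
- exact: le_lt_trans lt.
- exact: Sigma0_open.
- by apply: Sigma0_open => //; exact: open0.
Qed.

Lemma Sigma0W zeta xi A : (zeta <= xi)%O -> Sigma0 zeta A -> Sigma0 xi A.
Proof.
rewrite le_eqVlt => /predU1P[->//|lt] SA.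
rewrite (_ : A = \bigcup_(i : nat) (A `\` set0)); last first.
  by apply/seteqP; split=> [x Ax|x [_ _ []//]]; exists 0%N => //; split.
apply: (Sigma0_bigcup (zeta := fun=> zeta)) => // _.
by apply: open_Sigma0; exact: open0.
Qed.

(** [eta] is the level of the empty differences used at numbers that code no element of [K]. *)
Lemma Sigma0_bigcup_count (K : countType) xi eta (zeta : K -> W)
    (U V : K -> set T) : (eta < xi)%O -> (forall k, (zeta k < xi)%O) ->
  (forall k, Sigma0 (zeta k) (U k)) -> (forall k, Sigma0 (zeta k) (V k)) ->
  Sigma0 xi (\bigcup_k (U k `\` V k)).
Proof.
move=> lt lek hU hV.
pose ext S (s0 : S) (s : K -> S) n := if unpickle n is Some k then s k else s0.
rewrite (_ : \bigcup_k _ = \bigcup_n (ext _ set0 U n `\` ext _ set0 V n)).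
  have S0 : Sigma0 eta (set0 : set T) by apply: open_Sigma0; exact: open0.
  by apply: (Sigma0_bigcup (zeta := ext _ eta zeta)) => n; rewrite /ext;
    case: unpickle.
apply/seteqP; split=> [x [k _ Ux]|x [n _]].
  by exists (pickle k) => //; rewrite /ext pickleK.
by rewrite /ext; case: unpickle => [k Ux|[]//]; exists k.
Qed.

Lemma Sigma0_bigcup_same xi (A : nat -> set T) :
  (forall n, Sigma0 xi (A n)) -> Sigma0 xi (\bigcup_n A n).
Proof.
move=> SA; have [least|[eta lt]] := least_or_lt xi.
  by apply: Sigma0_open => //; apply: bigcup_open => n _; exact: Sigma0_least (SA n).
have /choice[p pP] : forall n, exists p : (nat -> W) * (nat -> set T) * (nat -> set T),
    [/\ forall i, (p.1.1 i < xi)%O, forall i, Sigma0 (p.1.1 i) (p.1.2 i),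
      forall i, Sigma0 (p.1.1 i) (p.2 i) & A n = \bigcup_i (p.1.2 i `\` p.2 i)].
  move=> n; have [zeta [U [V UVP]]] := Sigma0_bigcupP lt (SA n).
  by exists (zeta, U, V).
rewrite (_ : \bigcup_n A n = \bigcup_(k : nat * nat)
    ((p k.1).1.2 k.2 `\` (p k.1).2 k.2)).
  by apply: (@Sigma0_bigcup_count _ xi eta (fun k => (p k.1).1.1 k.2)) => // k;
    case: (pP k.1).
apply/seteqP; split=> [x [n _]|x [[n i] _ /= Ux]].
  by have [_ _ _ ->] := pP n => -[i _ Ux]; exists (n, i).
by exists n => //; have [_ _ _ ->] := pP n; exists i.
Qed.

Lemma Sigma0U xi A B : Sigma0 xi A -> Sigma0 xi B -> Sigma0 xi (A `|` B).
Proof.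
move=> SA SB; rewrite (_ : _ `|` _ = \bigcup_n (if n is 0%N then A else B)).
  by apply: Sigma0_bigcup_same => -[].
apply/seteqP; split=> [x [Ax|Bx]|x [[|n] _]]; [by exists 0%N|by exists 1%N| |].
  by left.
by right.
Qed.

(** The sets U \ V and U' \ V' meet in (U ∩ U') \ (V ∪ V'), whose two terms live at the larger of
    the two levels; the induction on [xi] handles U ∩ U'. *)
Lemma Sigma0I xi A B : Sigma0 xi A -> Sigma0 xi B -> Sigma0 xi (A `&` B).
Proof.
elim/(well_founded_ind wfW): xi A B => xi IH A B SA SB.
have [least|[eta lt]] := least_or_lt xi.
  by apply: Sigma0_open => //; apply: openI; exact: Sigma0_least least _.
have [z [U [V [zx SU SV ->]]]] := Sigma0_bigcupP lt SA.
have [z' [U' [V' [zx' SU' SV' ->]]]] := Sigma0_bigcupP lt SB.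
rewrite (_ : _ `&` _ = \bigcup_(k : nat * nat)
    ((U k.1 `&` U' k.2) `\` (V k.1 `|` V' k.2))).
  have ltmax k l : (Order.max (z k) (z' l) < xi)%O by rewrite gt_max zx zx'.
  have maxl k l : (z k <= Order.max (z k) (z' l))%O by rewrite le_max lexx.
  have maxr k l : (z' l <= Order.max (z k) (z' l))%O by rewrite le_max lexx orbT.
  apply: (@Sigma0_bigcup_count _ xi eta (fun k => Order.max (z k.1) (z' k.2))) => // k.
    by apply: IH => //; [exact: Sigma0W (maxl _ _) _|exact: Sigma0W (maxr _ _) _].
  by apply: Sigma0U; [exact: Sigma0W (maxl _ _) _|exact: Sigma0W (maxr _ _) _].
apply/seteqP; split=> [x [[i _ [Ux Vx]] [j _ [Ux' Vx']]]|x [[i j] _ [[Ux Ux'] nV]]].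
  by exists (i, j) => //; split=> // -[].
split; [exists i|exists j] => //; split=> // Vx; apply: nV; [left|right] => //.
Qed.

End SigmaZero.

Lemma Sigma0_baire_property (d : Order.disp_t) (W : orderType d)
    (S T : topologicalType) (f : S -> T) (xi : W) (A : set T) :
  @second_countable S -> continuous f -> Sigma0 xi A ->
  baire_property (f @^-1` A).
Proof.
move=> sc /continuousP cf; elim=> [{}xi U _ oU|{}xi zeta U V _ _ IHU _ IHV].
  by apply: baire_property_open; exact: cf.
rewrite preimage_bigcup; apply: baire_property_bigcup => // n.
exact: (baire_propertyD (A := f @^-1` U n) (B := f @^-1` V n) sc (IHU n) (IHV n)).
Qed.

(** * Making countably many sets clopen *)

Section BasisTopology.
Context {X K : Type} (b : K -> set X).
Hypothesis b_cover : forall x, exists k, b k x.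
Hypothesis b_setI : forall k l x, b k x -> b l x ->
  exists m, b m x /\ b m `<=` b k `&` b l.

Definition generated_open (A : set X) :=
  forall x, A x -> exists k, b k x /\ b k `<=` A.

Lemma generated_openT : generated_open setT.
Proof. by move=> x _; have [k kx] := b_cover x; exists k. Qed.

Lemma generated_openI : setI_closed generated_open.
Proof.
move=> A B oA oB x [/oA[k [kx kA]] /oB[l [lx lB]]].
have [m [mx mkl]] := b_setI kx lx.
by exists m; split=> // y /mkl[/kA ? /lB ?].
Qed.

Lemma generated_open_bigcup (F : set (set X)) : F `<=` generated_open ->
  generated_open (\bigcup_(U in F) U).
Proof.
move=> FO x [U FU /(FO U FU)[k [kx kU]]].
by exists k; split=> // y /kU Uy; exists U.
Qed.

Definition basis_topology : topology X := 
  Topology generated_openT generated_openI generated_open_bigcup.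

End BasisTopology.

Lemma bounded_choice (P : nat -> nat -> Prop) (n : nat) :
  (forall k m m', (m <= m')%N -> P k m -> P k m') ->
  (forall k, (k < n)%N -> exists m, P k m) ->
  exists m, forall k, (k < n)%N -> P k m.
Proof.
move=> mono; elim: n => [_|n IH h]; first by exists 0%N.
have [|m mP] := IH; first by move=> k kn; apply: h; rewrite ltnS ltnW.
have [m' m'P] := h n (ltnSn n).
exists (maxn m m') => k; rewrite ltnS leq_eqVlt => /predU1P[->|kn].
  exact: mono _ _ _ (leq_maxr _ _) m'P.
exact: mono _ _ _ (leq_maxl _ _) (mP k kn).
Qed.

Section ClopenRefinement.
Context {X : topologicalType} (L : nat -> set X).

Definition lattice_basis :=
  [/\ forall a b, exists c, L c = L a `&` L b,
      forall a b, exists c, L c = L a `|` L b,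
      exists c, L c = set0, exists c, L c = setT
    & forall x O, open O -> O x -> exists k, [/\ open (L k), L k x & L k `<=` O]].

Hypothesis latticeL : lattice_basis.

Definition Ldiff (p : nat * nat) := L p.1 `\` L p.2.

Lemma Ldiff_cover x : exists p, Ldiff p x.
Proof.
case: latticeL => _ _ [z z0] [t tT] _.
by exists (t, z); rewrite /Ldiff /= z0 tT; split.
Qed.

Lemma Ldiff_setI p q x : Ldiff p x -> Ldiff q x ->
  exists m, Ldiff m x /\ Ldiff m `<=` Ldiff p `&` Ldiff q.
Proof.
case: latticeL => LI LU _ _ _ [x1 nx1] [x2 nx2].
have [c cE] := LI p.1 q.1; have [e eE] := LU p.2 q.2.
exists (c, e); rewrite /Ldiff /= cE eE; split; first by split=> // -[].
by move=> y [[y1 y2] ne]; split; split=> // ?; apply: ne; [left|right].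
Qed.

(** The coarsest topology in which every [L k] is clopen; the lattice operations make the
    differences a basis. *)
Definition clopen_refinement : topology X :=
  basis_topology Ldiff_cover Ldiff_setI.

Lemma clopen_refinement_diff a b : clopen_refinement (L a `\` L b).
Proof. by move=> x abx; exists (a, b); split. Qed.

Lemma clopen_refinementL a : clopen_refinement (L a).
Proof.
case: latticeL => _ _ [z z0] _ _.
by have := @clopen_refinement_diff a z; rewrite z0 setD0.
Qed.

Lemma clopen_refinementC a : clopen_refinement (~` L a).
Proof.
case: latticeL => _ _ _ [t tT] _.
by have := @clopen_refinement_diff t a; rewrite tT setTD.
Qed.

Lemma clopen_refinement_finer : @open X `<=` clopen_refinement.
Proof.
case: latticeL => _ _ [z z0] _ bas O oO x Ox.
have [k [_ kx kO]] := bas x O oO Ox.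
exists (k, z); rewrite /Ldiff /= z0; split; first by split.
by move=> y [/kO].
Qed.

Context {d : Order.disp_t} {W : orderType d} (rank : nat -> W).
Hypothesis wfW : well_ordered W.
Hypothesis L_decomp : forall k, open (L k) \/ forall x, L k x -> exists a b,
  [/\ (rank a < rank k)%O, (rank b < rank k)%O, (L a `\` L b) x &
    L a `\` L b `<=` L k].

(* A position (j, n, x) is the set of points of U j on the same side as x of the
   first n sets. Along a chain, every promise to be in L k is witnessed by lower
   ranks, so that by induction on the rank the limit keeps all promises. *)
Lemma sieve_complete_clopen_refinement :
  sieve_complete X -> sieve_complete (retop clopen_refinement).
Proof.
move=> [J [U [r S]]]; case: (S) => Uo mono cov ref lim.
pose same n (x : X) := [set y : X | forall k, (k < n)%N -> L k y <-> L k x].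
pose pos (p : J * nat * X) : set X := U p.1.1 `&` same p.1.2 p.2.
pose step (p q : J * nat * X) := [/\ r p.1.1 q.1.1, (p.1.2 < q.1.2)%N,
  U q.1.1 q.2, same p.1.2 p.2 q.2 &
  forall k, (k < p.1.2)%N -> L k p.2 ->
    (open (L k) /\ U q.1.1 `<=` L k) \/ exists a b,
    [/\ (a < q.1.2)%N /\ (b < q.1.2)%N, (rank a < rank k)%O, (rank b < rank k)%O,
      (L a `\` L b) q.2 & L a `\` L b `<=` L k]].
exists (J * nat * X)%type, pos, step; split.
- move=> [[j n] x]; apply: openI.
    by apply: clopen_refinement_finer; exact: Uo.
  apply: (@open_below (retop clopen_refinement)
    (fun k => [set y | L k y <-> L k x])) => k _.
  have [Lx|Lx] := pselect (L k x).
    rewrite (_ : [set _ | _] = L k); first exact: clopen_refinementL.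
    by apply/seteqP; split=> y; [case=> _; apply|split].
  rewrite (_ : [set _ | _] = ~` L k); first exact: clopen_refinementC.
  by apply/seteqP; split=> y /=; [case=> h _ /h|split].
- move=> [[j n] x] [[j' n'] x'] [/= jj' nn' _ xx' _] y [/= y1 y2].
  split=> /=; first exact: mono _ _ jj' _ y1.
  move=> k kn; apply: iff_trans (xx' k kn); apply: y2.
  exact: leq_trans kn (ltnW nn').
- by move=> x; have [j jx] := cov x; exists (j, 0%N, x); split.
- move=> [[j n] x] y O [/= jy xy] oO Oy.
  have [[b c] [/= bcy bcO]] := oO y Oy.
  (* Promises about open members of [L] are kept by moving inside them. *)
  have [V [oV Vy VL]] : exists V : set X, [/\ @open X V, V y &
      forall k, (k < n)%N -> L k y -> open (L k) -> V `<=` L k].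
    pose F k : set X := if `[< L k y /\ open (L k) >] then L k else setT.
    exists [set z | forall k, (k < n)%N -> F k z]; split.
    + apply: (open_below (F := F)) => k _; rewrite /F.
      by case: asboolP => [[]//|_]; exact: openT.
    + by move=> k _; rewrite /F; case: asboolP => [[]|].
    + by move=> k kn Lk oL z /(_ k kn); rewrite /F asboolT.
  have [j' [jj' j'y j'V]] := ref j y V jy oV Vy.
  have [n' n'P] : exists m, forall k, (k < n)%N -> L k x ->
      (open (L k) /\ U j' `<=` L k) \/ exists a b,
      [/\ (a < m)%N /\ (b < m)%N, (rank a < rank k)%O, (rank b < rank k)%O,
        (L a `\` L b) y & L a `\` L b `<=` L k].
    apply: (@bounded_choice (fun k m => L k x ->
      (open (L k) /\ U j' `<=` L k) \/ exists a b,
      [/\ (a < m)%N /\ (b < m)%N, (rank a < rank k)%O, (rank b < rank k)%O,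
        (L a `\` L b) y & L a `\` L b `<=` L k])).
      move=> k m m' mm' h /h[|[a' [b' [[am bm] h1 h2 h3 h4]]]]; first by left.
      by right; exists a', b'; split=> //; split; exact: leq_trans mm'.
    move=> k kn; have [oL|dec] := L_decomp k.
      exists 0%N => Lx; left; split=> //; apply: subset_trans j'V _.
      by apply: VL => //; apply/xy.
    have [Ly|nLy] := pselect (L k y); last by exists 0%N => /(xy k kn).2.
    have [a' [b' [h1 h2 h3 h4]]] := dec y Ly.
    exists (maxn a' b').+1 => _; right; exists a', b'; split=> //.
    by rewrite !ltnS leq_maxl leq_maxr.
  (* [m] exceeds [n] and the indices of all witnesses, which the next move thus tracks; it also
     exceeds [b] and [c], so that agreement with [y] forces membership in the basic set inside
     [O]. *)
  pose m := maxn (maxn n.+1 n') (maxn b c).+1.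
  have nm : (n < m)%N by rewrite /m !leq_max leqnn.
  have n'm : (n' <= m)%N by rewrite /m !leq_max leqnn orbT.
  have bm : (b < m)%N by rewrite leq_max ltnS leq_maxl orbT.
  have cm : (c < m)%N by rewrite leq_max ltnS leq_maxr orbT.
  exists (j', m, y); split.
  + split=> //= k kn Lx; have [|[a' [b' [[am bm'] h1 h2 h3 h4]]]] := n'P k kn Lx.
      by left.
    by right; exists a', b'; split=> //; split; exact: leq_trans n'm.
  + by split.
  + move=> z [/= _ zy]; apply: bcO; case: bcy => by' cy'.
    by split; [apply/(zy b bm)|move=> /(zy c cm)].
- move=> s sP.
  pose j i := (s i).1.1; pose n i := (s i).1.2; pose x i := (s i).2.
  have jr i : r (j i) (j i.+1) by case: (sP i).
  have [z [zU zlim]] := lim _ jr.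
  have nS i : (n i < n i.+1)%N by case: (sP i).
  have ni i : (i <= n i)%N by elim: i => [//|i IH]; exact: leq_ltn_trans IH (nS i).
  have nmono i l : (i <= l)%N -> (n i <= n l)%N.
    by move=> /subnK <-; elim: (l - i)%N => [//|m IH]; exact: leq_trans IH (ltnW (nS _)).
  have agree i l k : (i <= l)%N -> (k < n i)%N -> L k (x l) <-> L k (x i).
    move=> /subnK <- kn; elim: (l - i)%N => [//|m IH].
    apply: iff_trans IH; have [_ _ _ h _] := sP (m + i)%N; apply: h.
    exact: leq_trans kn (nmono _ _ (leq_addl _ _)).
  have Ux i : U (j i.+1) (x i.+1) by case: (sP i).
  (* The side of [L k] is settled from stage [k.+1] on, because [k < n k.+1]. *)
  have zL k : L k z <-> L k (x k.+1).
    suff: forall w, forall k, rank k = w -> L k z <-> L k (x k.+1) by exact.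
    move=> w; elim/(well_founded_ind wfW): w => w IH {}k kw.
    have agk i : (k < i)%N -> L k (x i) <-> L k (x k.+1).
      by move=> ki; apply: agree => //; exact: ni k.+1.
    have IHa a i : (rank a < rank k)%O -> (a < i)%N -> L a z <-> L a (x i).
      move=> ak ai; rewrite kw in ak; apply: iff_trans (IH _ ak a erefl) _.
      by apply: iff_sym; apply: agree => //; exact: ni a.+1.
    split=> [Lz|Lx].
      have [oL|dec] := L_decomp k.
        have [i iL] := zlim _ oL Lz.
        apply/(agk (maxn i k).+1); first by rewrite ltnS leq_maxr.
        apply: iL; apply: (sieve_chain_subset S jr _ (Ux (maxn i k))).
        by rewrite leqW// leq_maxl.
      have [a [b [ak bk [Laz Lbz] abL]]] := dec z Lz.
      pose i := (maxn k (maxn a b)).+1.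
      have ai : (a < i)%N by rewrite ltnS !leq_max leqnn !orbT.
      have bi : (b < i)%N by rewrite ltnS !leq_max leqnn !orbT.
      apply/(agk i); first by rewrite ltnS leq_max leqnn.
      apply: abL; split; first by apply/(IHa a i ak ai).
      by move=> /(IHa b i bk bi).
    (* This move either puts the next set of the old sieve inside the open [L k] or names witnesses
       of lower rank, to which the induction applies. *)
    have [_ _ _ _ h] := sP k.+1.
    have [[oL UL]|[a [b [[an bn] ak bk [La Lb] abL]]]] := h k (ni k.+1) Lx.
      by apply: UL; exact: zU.
    have lift e : (rank e < rank k)%O -> (e < n k.+2)%N -> L e z <-> L e (x k.+2).
      move=> ek en; pose i := maxn e.+1 k.+2.
      apply: iff_trans (IHa e i ek (leq_maxl _ _)) _.
      by apply: agree => //; exact: leq_maxr.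
    apply: abL; split; first by apply/(lift a ak an).
    by move=> /(lift b bk bn).
  have zs i : same (n i) (x i) z.
    move=> k kn; apply: iff_trans (zL k) _; pose l := maxn k.+1 i.
    apply: iff_trans (iff_sym (agree k.+1 l k (leq_maxl _ _) (ni k.+1))) _.
    exact: agree i l k (leq_maxr _ _) kn.
  exists z; split=> [i|O oO Oz]; first by split; [exact: zU|exact: zs].
  have [[b c] [[/= bz cz] bcO]] := oO z Oz.
  pose i := (maxn b c).+1.
  exists i => y [_ /= ys]; apply: bcO.
  have bi : (b < n i)%N by apply: leq_trans (ni i); rewrite ltnS leq_maxl.
  have ci : (c < n i)%N by apply: leq_trans (ni i); rewrite ltnS leq_maxr.
  split=> /=; first by apply/(ys b bi)/(zs i b bi).
  by move=> /(ys c ci)/(zs i c ci).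
Qed.

End ClopenRefinement.

(** * Vaught transforms *)

Section Vaught.
Context {G : topologicalGroupType} {X : topologicalType}.
Variable act : G -> X -> X.
Hypothesis actP : continuous_action act.
Hypothesis sieveG : sieve_complete G.
Hypothesis scG : @second_countable G.

Local Notation "U ** A" := (vaught_transform act U A) (at level 40).

Lemma act1 x : act 1%g x = x. Proof. by case: actP. Qed.

Lemma actM g h x : act (g * h)%g x = act g (act h x). Proof. by case: actP. Qed.

Lemma actK g : cancel (act g) (act g^-1%g).
Proof. by move=> x; rewrite -actM mulVg act1. Qed.

Lemma actKV g : cancel (act g^-1%g) (act g).
Proof. by move=> x; rewrite -actM mulgV act1. Qed.

Lemma act_imageE g (A : set X) x : (act g @` A) x <-> A (act g^-1%g x).
Proof.
split=> [[y Ay <-]|Ax]; first by rewrite actK.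
by exists (act g^-1%g x) => //; rewrite actKV.
Qed.

Lemma act_nbhs g x O : open O -> O (act g x) ->
  exists N M, [/\ open N, open M, N g, M x &
    forall h y, N h -> M y -> O (act h y)].
Proof.
case: actP => _ _ ca oO Ogx.
have : nbhs (g, x) ((fun p : G * X => act p.1 p.2) @^-1` O).
  by apply: ca; exact: open_nbhs_nbhs.
move=> [[A B] [/= nA nB] AB].
exists A°, B°; split; [exact: open_interior|exact: open_interior|exact: nA|exact: nB|].
by move=> h y /interior_subset Ah /interior_subset By; exact: (AB (h, y)).
Qed.

Lemma mulg_nbhs (g h : G) O : open O -> O (g * h)%g ->
  exists N M, [/\ open N, open M, N g, M h &
    forall k l, N k -> M l -> O (k * l)%g].
Proof.
move=> oO Ogh.
have : nbhs (g, h) ((fun p : G * G => (p.1 * p.2)%g) @^-1` O).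
  by apply: mulg_continuous; exact: open_nbhs_nbhs.
move=> [[A B] [/= nA nB] AB].
exists A°, B°; split; [exact: open_interior|exact: open_interior|exact: nA|exact: nB|].
by move=> k l /interior_subset Ak /interior_subset Bl; exact: (AB (k, l)).
Qed.

Lemma mulgl_continuous (g : G) : continuous (fun h : G => (g * h)%g).
Proof.
move=> h; apply: (@continuous_comp G (G * G)%type G (fun k => (g, k))
  (fun p => (p.1 * p.2)%g)); last exact: mulg_continuous.
by apply: cvg_pair; [exact: cvg_cst|exact: cvg_id].
Qed.

Lemma meager_mulg (g : G) (S : set G) :
  meager S -> meager [set h | S (g * h)%g].
Proof.
apply: (@meager_preimage _ (fun h => (g * h)%g) (fun h => (g^-1 * h)%g));
  try exact: mulgl_continuous.
  by move=> h; rewrite mulgA mulVg mul1g.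
by move=> h; rewrite mulgA mulgV mul1g.
Qed.

Lemma act_inv_continuous x : continuous (fun g => act g^-1%g x).
Proof.
apply/continuousP => O oO; rewrite openE => g /= Og.
have [N [M [oN _ Ng Mx NM]]] := act_nbhs oO Og.
have nN : nbhs g^-1%g N by exact: open_nbhs_nbhs.
have : nbhs g [set h : G | N h^-1%g] by exact: (@invg_continuous G g N nN).
by apply: (@filterS _ (nbhs g)) => h Nh; exact: NM.
Qed.

Lemma act_continuous g : continuous (act g).
Proof.
apply/continuousP => O oO; rewrite openE => x /= Ox.
have [N [M [_ oM Ng Mx NM]]] := act_nbhs oO Ox.
by rewrite /interior nbhsE; exists M => // y My; exact: NM.
Qed.

Definition returns (A : set X) x := [set g : G | A (act g^-1%g x)].

Lemma vaughtE U A x : (U ** A) x <-> ~ meager (U `&` returns A x).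
Proof.
rewrite /vaught_transform /= (_ : [set g | _] = U `&` returns A x)//.
by apply/seteqP; split=> g [Ug /act_imageE].
Qed.

Lemma vaughtS U V A B : U `<=` V -> A `<=` B -> U ** A `<=` V ** B.
Proof.
move=> UV AB x /vaughtE h; apply/vaughtE; apply: contra_not h.
by apply: meagerS => g [/UV ? /AB].
Qed.

Lemma vaught_witness U A x : (U ** A) x -> exists g, U g /\ A (act g^-1%g x).
Proof.
move=> /vaughtE h; apply: contrapT => no; apply: h.
by apply: meagerS meager0 => g Ug; case: no; exists g.
Qed.

Lemma vaught_bigcup U (A : nat -> set X) x :
  (U ** (\bigcup_i A i)) x -> exists i, (U ** A i) x.
Proof.
move=> /vaughtE h; apply: contrapT => no; apply: h.
apply: (@meagerS _ _ (\bigcup_i (U `&` returns (A i) x))).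
  by move=> g [Ug [i _ Ai]]; exists i.
apply: meager_bigcup => i; apply: contrapT => nm; apply: no; exists i.
exact/vaughtE.
Qed.

Lemma vaught_full U A x : open U -> U !=set0 ->
  (forall g, U g -> A (act g^-1%g x)) -> (U ** A) x.
Proof.
move=> oU Un h; apply/vaughtE => m; apply: (baire_category sieveG oU Un).
by apply: meagerS m => g Ug; split=> //; exact: h.
Qed.

Lemma vaught_openE U A x : open U -> open A ->
  (U ** A) x <-> exists g, U g /\ A (act g^-1%g x).
Proof.
move=> oU oA; split; first exact: vaught_witness.
move=> [g [Ug Ag]]; have /continuousP/(_ A oA) oR := @act_inv_continuous x.
apply: (@vaughtS (U `&` returns A x) U A A) => //.
by apply: vaught_full; [exact: openI|exists g|move=> h []].
Qed.

Lemma vaught_open U A : open U -> open A -> open (U ** A).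
Proof.
move=> oU oA; rewrite openE => x /(vaught_openE _ oU oA)[g [Ug Ag]].
have /continuousP/(_ A oA) oN := @act_continuous g^-1%g.
rewrite /interior nbhsE; exists (act g^-1%g @^-1` A); first by split.
by move=> y Ay; apply/vaught_openE => //; exists g.
Qed.

(** One inclusion of the identity g (V ** A) = (gV) ** A, from the invariance of meagerness under
    left translation. *)
Lemma vaught_translate U V A g x : (forall k, V k -> U (g * k)%g) ->
  (V ** A) x -> (U ** A) (act g x).
Proof.
move=> VU /vaughtE h; apply/vaughtE; apply: contra_not h => /(meager_mulg g).
apply: meagerS => k [Vk Ak]; split; first exact: VU.
by rewrite /returns /= invgM actM actK.
Qed.

Lemma vaught_diff_sub U B C x : (U ** B) x -> ~ (U ** C) x -> (U ** (B `\` C)) x.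
Proof.
move=> /vaughtE hB /vaughtE/contrapT hC; apply/vaughtE; apply: contra_not hB => hD.
apply: meagerS (meagerU hC hD) => g [Ug Bg].
by have [Cg|Cg] := pselect (C (act g^-1%g x)); [left|right].
Qed.

Variable u : nat -> set G.
Hypothesis u_open : forall n, open (u n).
Hypothesis u_basis : forall g O, open O -> O g -> exists n, u n g /\ u n `<=` O.

(** The set g^-1 U is covered by the countably many [u n] such that N (u n) lies in [U] for some
    neighbourhood [N] of [g]; one of them carries a nonmeager part. Continuity of the action in the
    new topology comes from here. *)
Lemma vaught_act U A g x : open U -> (U ** A) (act g x) -> exists N n,
  [/\ open N, N g, forall h k, N h -> u n k -> U (h * k)%g & (u n ** A) x].
Proof.
move=> oU /vaughtE h; apply: contrapT => no; apply: h.
pose good n := exists N, [/\ open N, N g & forall h k, N h -> u n k -> U (h * k)%g].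
pose M := \bigcup_n (if `[< good n >] then u n `&` returns A x else set0).
have mM : meager M.
  apply: meager_bigcup => n; case: asboolP => [[N [oN Ng NU]]|_]; last exact: meager0.
  apply: contrapT => nm; apply: no; exists N, n; split=> //; exact/vaughtE.
apply: meagerS (meager_mulg g^-1%g mM) => k [Uk Ak] /=.
have : U (g * (g^-1 * k))%g by rewrite mulgA mulgV mul1g.
move=> /(mulg_nbhs oU)[N [N' [oN oN' Ng N'k NN']]].
have [n [nk nN']] := u_basis oN' N'k.
exists n => //; rewrite asboolT; last first.
  by exists N; split=> // h l Nh /nN'; exact: NN'.
by split=> //; rewrite /returns /= invgM invgK actM.
Qed.

Lemma vaught_shrink U A x : open U -> (U ** A) x -> exists N n,
  [/\ open N, N 1%g, forall h, N h -> N h^-1%g,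
    forall h k, N h -> u n k -> U (h * k)%g & (u n ** A) x].
Proof.
move=> oU; rewrite -{1}[x]act1 => /(vaught_act oU)[N [n [oN N1 NU nx]]].
have /continuousP/(_ N oN) oN' := @invg_continuous G.
exists (N `&` [set h | N h^-1%g]), n; split=> //.
- exact: openI.
- by split=> //=; rewrite invg1.
- by move=> h [Nh Nh']; split=> //=; rewrite invgK.
- by move=> h k [Nh _]; exact: NU.
Qed.

Lemma vaught_basis U A x : open U -> (U ** A) x ->
  exists n, u n `<=` U /\ (u n ** A) x.
Proof.
move=> oU /(vaught_shrink oU)[N [n [_ N1 _ NU nx]]]; exists n; split=> // k nk.
by rewrite -[k]mul1g; exact: NU.
Qed.

Context {d : Order.disp_t} {W : orderType d}.
Hypothesis wfW : well_ordered W.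

Lemma returns_baire_property (xi : W) A x : Sigma0 xi A ->
  baire_property (returns A x).
Proof. exact: Sigma0_baire_property scG (@act_inv_continuous x). Qed.

(** The return set of B \ C is comeager in some basic [u n] inside [U]; there the returns to [B] are
    nonmeager and those to [C] meager. *)
Lemma vaught_diff (xi zeta : W) U B C x : open U -> Sigma0 xi B -> Sigma0 zeta C ->
  (U ** (B `\` C)) x ->
  exists n, [/\ u n `<=` U, (u n ** B) x & ~ (u n ** C) x].
Proof.
move=> oU SB SC /vaughtE h.
have [] := nonmeager_comeager scG _ oU h.
  apply: (@baire_propertyD _ (returns B x) (returns C x)) => //;
  [exact: returns_baire_property SB|exact: returns_baire_property SC].
move=> V [oV [g Vg] VU mV]; have [n [ng nV]] := u_basis oV Vg.
exists n; split; first exact: subset_trans nV VU.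
  apply/vaughtE => m; apply: (baire_category sieveG (u_open n)); first by exists g.
  apply: meagerS (meagerU m mV) => k nk.
  have [Bk|Bk] := pselect (B (act k^-1%g x)); first by left.
  by right; split; [exact: nV|case].
move/vaughtE; apply; apply: meagerS mV => k [nk Ck].
by split; [exact: nV|case].
Qed.

Lemma vaught_Sigma0 (xi : W) U A : open U -> Sigma0 xi A -> Sigma0 xi (U ** A).
Proof.
move=> + SA; elim: SA U => [{}xi B least oB U oU|{}xi zeta B C lt SB IHB SC IHC U oU].
  by apply: Sigma0_open => //; exact: vaught_open.
(* Basic sets not included in [U] are replaced by the empty set, whose transforms are empty. *)
pose v n := if `[< u n `<=` U >] then u n else set0.
have v_open n : open (v n) by rewrite /v; case: asboolP => _ //; exact: open0.
have vU n : v n `<=` U by rewrite /v; case: asboolP => // _ ? [].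
rewrite (_ : U ** _ = \bigcup_(k : nat * nat) (v k.2 ** B k.1 `\` v k.2 ** C k.1)).
  by apply: (@Sigma0_bigcup_count _ _ wfW _ _ xi (zeta 0%N) (fun k => zeta k.1)) => // k;
    [exact: IHB|exact: IHC].
apply/seteqP; split=> [x /vaught_bigcup[i /(vaught_diff oU (SB i) (SC i))]|].
  by move=> [n [nU nB nC]]; exists (i, n) => //; rewrite /v /= asboolT.
move=> x [[i n] _ [/= vB vC]]; have := vaught_diff_sub vB vC.
by apply: (vaughtS (vU n)) => y By; exists i.
Qed.

End Vaught.

(** * The topology of Vaught transforms *)

Section VaughtTopology.
Context {G : topologicalGroupType} {X : topologicalType}.
Variable act : G -> X -> X.
Hypothesis actP : continuous_action act.
Hypothesis sieveG : sieve_complete G.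
Hypothesis scG : @second_countable G.
Variable u : nat -> set G.
Hypothesis u_open : forall n, open (u n).
Hypothesis u_basis : forall g O, open O -> O g -> exists n, u n g /\ u n `<=` O.
Context {d : Order.disp_t} {W : orderType d}.
Hypothesis wfW : well_ordered W.
Variables (L : nat -> set X) (rank : nat -> W).
Hypothesis latticeL : lattice_basis L.
Hypothesis L_Sigma0 : forall k, Sigma0 (rank k) (L k).
Hypothesis L_vaught : forall n k, exists c, L c = vaught_transform act (u n) (L k).

Local Notation "U ** A" := (vaught_transform act U A) (at level 40).

Definition Vbasis (p : nat * (nat * nat)) := u p.1 ** Ldiff L p.2.

Let LdiffI p q : exists m, Ldiff L m = Ldiff L p `&` Ldiff L q.
Proof.
case: latticeL => LI LU _ _ _.
have [c cE] := LI p.1 q.1; have [e eE] := LU p.2 q.2.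
exists (c, e); rewrite /Ldiff /= cE eE; apply/seteqP; split=> x.
  by move=> [[x1 x2] ne]; split; split=> // ?; apply: ne; [left|right].
by move=> [[x1 x2] [x3 x4]]; split=> // -[].
Qed.

Let Ldiff_empty : exists z, L z = set0. Proof. by case: latticeL. Qed.
Let Ldiff_full : exists t, L t = setT. Proof. by case: latticeL. Qed.

(** For B and C in L, the difference of [u n ** B] and [u n ** C] is again a difference of members
    of L; so transforms are open in the clopen refinement. *)
Let vaught_Ldiff U q x : open U -> (U ** Ldiff L q) x -> exists n e,
  [/\ u n `<=` U, Ldiff L e x & Ldiff L e `<=` u n ** Ldiff L q].
Proof.
move=> oU /(vaught_diff actP sieveG scG u_open u_basis oU (L_Sigma0 _) (L_Sigma0 _)).
move=> [n [nU nB nC]].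
have [b bE] := L_vaught n q.1; have [c cE] := L_vaught n q.2.
exists n, (b, c); rewrite /Ldiff /= bE cE; split=> // y [yb yc].
exact: vaught_diff_sub.
Qed.

(* Only meagerly many g fail this, since there are countably many p. *)
Lemma generic_translate U A x : (U ** A) x -> exists g, [/\ U g, A (act g^-1%g x) &
  forall p, u p.1 g -> Ldiff L p.2 (act g^-1%g x) -> Vbasis p x].
Proof.
move=> /(vaughtE actP) h; apply: contrapT => no; apply: h.
pose M (p : nat * (nat * nat)) := u p.1 `&` returns act (Ldiff L p.2) x.
apply: (@meagerS _ _ (\bigcup_p (if `[< Vbasis p x >] then set0 else M p))).
  move=> g [Ug Ag]; apply: contrapT => nM; apply: no; exists g; split=> // p pg pA.
  apply: contrapT => np; apply: nM; exists p => //; rewrite asboolF//.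
apply: meager_bigcup_count => p; case: asboolP => [_|np]; first exact: meager0.
by apply: contrapT => nm; apply: np; apply/(vaughtE actP).
Qed.

Lemma Vbasis_cover x : exists p, Vbasis p x.
Proof.
have [z z0] := Ldiff_empty; have [t tT] := Ldiff_full.
have [n [n1 _]] := @u_basis 1%g setT openT I.
exists (n, (t, z)); apply: vaught_full => //; first by exists 1%g.
by move=> g _; rewrite /Ldiff /= z0 tT; split.
Qed.

(** Write x = g x' with [g] generic. Near [g], and on some difference of L around x', the action
    stays inside [Vbasis q]. Genericity puts [x] in the transform, over a small neighbourhood of
    [g], of the intersection of this difference with the one of [p]. *)
Lemma Vbasis_setI p q x : Vbasis p x -> Vbasis q x ->
  exists m, Vbasis m x /\ Vbasis m `<=` Vbasis p `&` Vbasis q.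
Proof.
move=> /generic_translate[g [pg pA gen]] qx.
have : Vbasis q (act g (act g^-1%g x)) by rewrite actKV.
move=> /(vaught_act actP u_basis (u_open _))[N [n [oN Ng NU]]].
move=> /(vaught_Ldiff (u_open n))[n' [e [n'n ex eV]]].
have [m [mg mN]] := u_basis (openI oN (u_open p.1)) (conj Ng pg).
have [f fE] := LdiffI p.2 e.
exists (m, f); split; first by apply: gen => //=; rewrite fE.
move=> y my; split.
  by apply: (vaughtS actP _ _ my) => [k /mN[]//|z /=]; rewrite fE => -[].
have [h [mh fh]] := vaught_witness actP my.
move: fh; rewrite /= fE => -[_ /eV eh].
rewrite -[y](actKV actP h); apply: (vaught_translate actP _ eh) => k nk.
by apply: NU; [case: (mN h mh)|exact: n'n].
Qed.

Definition vaught_topology : topology X := basis_topology Vbasis_cover Vbasis_setI.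

Local Notation rho := vaught_topology.

Lemma vaught_topology_vaught U q : open U -> rho (U ** Ldiff L q).
Proof.
move=> oU x /(vaught_basis actP u_basis oU)[n [nU nx]].
by exists (n, q); split=> //; exact: (vaughtS actP).
Qed.

Lemma vaught_topology_vaughtL U k : open U -> rho (U ** L k).
Proof.
move=> oU; have [z z0] := Ldiff_empty.
by have := @vaught_topology_vaught U (k, z) oU; rewrite /Ldiff /= z0 setD0.
Qed.

Lemma vaught_topology_vaughtC U k : open U -> rho (U ** (~` L k)).
Proof.
move=> oU; have [t tT] := Ldiff_full.
by have := @vaught_topology_vaught U (t, k) oU; rewrite /Ldiff /= tT setTD.
Qed.

Lemma vaught_topology_finer : @open X `<=` rho.
Proof.
case: latticeL => _ _ [z z0] _ bas O oO x Ox.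
have : O (act 1%g x) by rewrite act1.
move=> /(act_nbhs actP oO)[N [M [oN oM N1 Mx NM]]].
have [k [oL kx kM]] := bas x M oM Mx; have [n [n1 nN]] := u_basis oN N1.
exists (n, (k, z)); rewrite /Vbasis /Ldiff /= z0 setD0; split.
  by apply/vaught_openE => //; exists 1%g; rewrite invg1 act1.
move=> y /(vaught_witness actP)[g [ng kg]].
by rewrite -[y](actKV actP g); apply: NM; [exact: nN|exact: kM].
Qed.

Lemma vaught_topology_action : @continuous_action G (retop rho) act.
Proof.
split; [exact: (act1 actP)|exact: (actM actP)|].
apply/continuousP => O oO; rewrite openE.
move=> [g x] /= /oO[[n q] [/= gx pO]].
have [N [m [oN Ng NU mx]]] := vaught_act actP u_basis (u_open n) gx.
exists (N, Vbasis (m, q)) => /=.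
  split; first exact: open_nbhs_nbhs.
  by apply: (@open_nbhs_nbhs (retop rho)); split=> //;
    exact: vaught_topology_vaught.
move=> [h y] [/= Nh my]; apply: pO.
by apply: (vaught_translate actP _ my) => k mk; exact: NU.
Qed.

Lemma vaught_topology_second_countable : @second_countable (retop rho).
Proof.
exists (range Vbasis); first exact: sub_countable (card_image_le _ _) (countableP _).
split=> [_ [p _ <-]|x O]; first exact: vaught_topology_vaught.
rewrite nbhsE => -[V [oV Vx] VO]; have [p [px pV]] := oV x Vx.
by exists (Vbasis p); [split=> //; exists p|exact: subset_trans pV VO].
Qed.

Lemma vaught_topology_Sigma0 (xi : W) : (forall k, (rank k < xi)%O) ->
  rho `<=` Sigma0 xi.
Proof.
move=> lt O oO.
have VS p : Sigma0 xi (Vbasis p).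
  apply: vaught_Sigma0 => //; pose eta := Order.max (rank p.2.1) (rank p.2.2).
  rewrite (_ : Ldiff L p.2 = \bigcup_(i : nat) (L p.2.1 `\` L p.2.2)); last first.
    by apply/seteqP; split=> [x px|x [_ _ []//]]; exists 0%N.
  apply: (Sigma0_bigcup (zeta := fun=> eta)) => _.
  - by rewrite gt_max !lt.
  - by apply: (Sigma0W wfW _ (L_Sigma0 _)); rewrite le_max lexx.
  - by apply: (Sigma0W wfW _ (L_Sigma0 _)); rewrite le_max lexx orbT.
rewrite (_ : O = \bigcup_n (if unpickle n is Some p then
    if `[< Vbasis p `<=` O >] then Vbasis p else set0 else set0)).
  have S0 : Sigma0 xi (set0 : set X) by apply: open_Sigma0 => //; exact: open0.
  apply: Sigma0_bigcup_same => // n; case: unpickle => [p|//].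
  by case: asboolP.
apply/seteqP; split=> [x /oO[p [px pO]]|x [n _]].
  by exists (pickle p) => //; rewrite pickleK asboolT.
by case: unpickle => [p|//]; case: asboolP => // pO /pO.
Qed.

(** [Q] is the transform by [N] of the complement of [u n ** L k], and is open because [u n ** L k]
    belongs to L. It contains the complement of [U ** L k] since N (u n) lies in [U], and misses
    [u m ** L k] since N^-1 (u m) lies in [u n]. *)
Lemma vaught_compl_nbhs (N U : set G) n m k : open N -> N 1%g ->
  (forall h, N h -> N h^-1%g) ->
  (forall h l, N h -> u n l -> U (h * l)%g) ->
  (forall h l, N h -> u m l -> u n (h * l)%g) ->
  exists Q, [/\ rho Q, ~` (U ** L k) `<=` Q & Q `<=` ~` (u m ** L k)].
Proof.
move=> oN N1 NV NU Nn; have [c cE] := L_vaught n k.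
exists (N ** (~` L c)); split; first exact: vaught_topology_vaughtC.
  move=> x nx; apply: vaught_full => //; first by exists 1%g.
  move=> g Ng; rewrite /setC /= cE => h; apply: nx.
  rewrite -[x](actKV actP g); apply: (vaught_translate actP _ h) => l.
  exact: NU.
move=> x /(vaught_witness actP)[g [Ng]]; rewrite /setC /= cE => ng mx; apply: ng.
by apply: (vaught_translate actP _ mx) => l; apply: Nn; exact: NV.
Qed.

(** This puts the closure of the smaller transform inside the larger one; two successive shrinkings
    provide the margins for [vaught_compl_nbhs]. *)
Lemma vaught_closed_nbhs U k x : open U -> (U ** L k) x ->
  exists2 n, (u n ** L k) x &
    forall y, ~ (U ** L k) y -> exists Q, [/\ rho Q, Q y & Q `<=` ~` (u n ** L k)].
Proof.
move=> oU /(vaught_shrink actP u_basis oU)[N1 [n [N1o N11 V1 NU nx]]].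
have [N2 [m [N2o N21 V2 Nn mx]]] := vaught_shrink actP u_basis (u_open n) nx.
exists m => // y ny.
have [||||| Q [Qo UQ Qm]] := @vaught_compl_nbhs (N1 `&` N2) U n m k.
- exact: openI.
- by [].
- by move=> h [? ?]; split; [exact: V1|exact: V2].
- by move=> h l [? _]; exact: NU.
- by move=> h l [_ ?]; exact: Nn.
by exists Q; split=> //; exact: UQ.
Qed.

(** For a difference B \ C the transform of [B] is shrunk and the complement of the transform of [C]
    is enlarged. Both closures are controlled at the same intermediate [u n2], where
    [vaught_diff_sub] recombines them. *)
Lemma vaught_topology_regular : regular_space (retop rho).
Proof.
move=> x O; rewrite {1}nbhsE => -[V [oV Vx] VO].
have [[n0 q] [/= px pO]] := oV x Vx.
move: px => /(vaught_diff actP sieveG scG u_open u_basis (u_open n0)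
  (L_Sigma0 _) (L_Sigma0 _))[n [nn0 nB nC]].
have [N1 [n1 [N1o N11 V1 NU n1B]]] := vaught_shrink actP u_basis (u_open n) nB.
have [N2 [n2 [N2o N21 V2 Nn n2B]]] := vaught_shrink actP u_basis (u_open n1) n1B.
have [||||| Q [Qo UQ Qm]] := @vaught_compl_nbhs (N1 `&` N2) (u n) n1 n2 q.2.
- exact: openI.
- by [].
- by move=> h [? ?]; split; [exact: V1|exact: V2].
- by move=> h l [? _]; exact: NU.
- by move=> h l [_ ?]; exact: Nn.
have n2n : u n2 `<=` u n.
  move=> l n2l; have n1l : u n1 l by rewrite -[l]mul1g; exact: Nn.
  by rewrite -[l]mul1g; exact: NU.
have [n3 n3B n3P] := vaught_closed_nbhs (u_open n2) n2B.
exists ((u n3 ** L q.1) `&` Q).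
  apply: (@open_nbhs_nbhs (retop rho)); split; last by split=> //; exact: UQ.
  by apply: is_openI => //; exact: vaught_topology_vaughtL.
move=> y cy; apply/VO/pO; apply: (vaughtS actP (subset_trans n2n nn0) (@subset_refl _ _)).
apply: vaught_diff_sub => //.
  apply: contrapT => /n3P[Q' [oQ' Q'y Q'n]].
  have [|z [[zn _] /Q'n nz]] := cy Q'; last exact: nz.
  exact: (@open_nbhs_nbhs (retop rho)).
move=> n2y; have [|z [[_ /Qm nz] zn]] := cy (u n2 ** L q.2); last exact: nz.
apply: (@open_nbhs_nbhs (retop rho)); split=> //.
exact: vaught_topology_vaughtL.
Qed.

(** If [u n] absorbs an open subgroup on the left, [vaught_compl_nbhs] applies with all three sets
    equal to [u n], so the complement of [u n ** L k] is itself open. *)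
Lemma vaught_topology_clopen :
  (forall n, exists2 H, open_subgroup H &
    forall h l, H h -> u n l -> u n (h * l)%g) ->
  has_clopen_basis (retop rho).
Proof.
move=> uH; have cC n k : rho (~` (u n ** L k)).
  have [H [oH H1 _ HV] Hu] := uH n.
  have [Q [oQ Q1 Q2]] := @vaught_compl_nbhs H (u n) n n k oH H1 HV Hu Hu.
  by rewrite (_ : ~` _ = Q)//; apply/seteqP.
split=> [A []//|x O]; rewrite nbhsE => -[V [oV Vx] VO].
have [[n0 q] [/= px pO]] := oV x Vx.
move: px => /(vaught_diff actP sieveG scG u_open u_basis (u_open n0)
  (L_Sigma0 _) (L_Sigma0 _))[n [nn0 nB nC]].
exists ((u n ** L q.1) `\` (u n ** L q.2)).
  split; last by split.
  split; first by rewrite setDE; apply: is_openI => //; exact: vaught_topology_vaughtL.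
  rewrite -[_ `\` _]setCK; apply: (@open_closedC (retop rho)).
  rewrite setDE setCI setCK; apply: (@openU (retop rho)).
    exact: cC.
  exact: vaught_topology_vaughtL.
move=> y [yB yC]; apply/VO/pO.
apply: (vaughtS actP nn0 (@subset_refl _ _)); exact: vaught_diff_sub.
Qed.

Hypothesis L_decomp : forall k, open (L k) \/ forall x, L k x -> exists a b,
  [/\ (rank a < rank k)%O, (rank b < rank k)%O, (L a `\` L b) x &
    L a `\` L b `<=` L k].

(* The action map from G times the clopen refinement is open and continuous on
   the Pi^0_2 set of the pairs that are generic in the sense of
   generic_translate. *)
Lemma vaught_topology_sieve : sieve_complete X -> sieve_complete (retop rho).
Proof.
move=> sX; pose tau := clopen_refinement latticeL.
have := sieve_complete_prod sieveG
  (sieve_complete_clopen_refinement latticeL wfW L_decomp sX).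
(* Numbers that code no triple repeat the condition of one fixed triple. *)
pose code k : nat * (nat * nat) := odflt (0, (0, 0))%N (unpickle k).
have codeK p : code (pickle p) = p by rewrite /code pickleK.
pose f (p : G * retop tau) : retop rho := act p.1 p.2.
have f_cts (O : set X) : rho O -> open (f @^-1` O).
  move=> oO; rewrite openE => -[g x] /oO[[n q] [/= gx pO]].
  have [N [m [oN Ng NU mx]]] := vaught_act actP u_basis (u_open n) gx.
  have [n' [e [n'm ex eV]]] := vaught_Ldiff (u_open m) mx.
  exists (N, Ldiff L e) => /=.
    split; first exact: open_nbhs_nbhs.
    apply: (@open_nbhs_nbhs (retop tau)); split=> //.
    exact: clopen_refinement_diff.
  move=> [h y] [/= Nh /eV ey]; apply: pO.
  by apply: (vaught_translate actP _ ey) => k /n'm mk; exact: NU.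
pose Wk k : set (G * retop tau) := u (code k).1 `*` Ldiff L (code k).2.
pose Pk k := f @^-1` Vbasis (code k).
(* The pair is [g] and g^-1 x for a generic [g]; this gives surjectivity, and below also
   openness. *)
have genY U A x : (U ** A) x -> exists p, [/\ U p.1, A p.2, f p = x &
    forall k, Wk k p -> Pk k p].
  move=> /generic_translate[g [Ug Ag gen]]; exists (g, act g^-1%g x).
  have fx : f (g, act g^-1%g x) = x by rewrite /f /= actKV.
  by split=> // k [ug Lg]; rewrite /Pk /preimage /= fx; exact: gen.
move=> sGX; apply: (@sieve_complete_image (G * retop tau)%type (retop rho) Wk Pk f) => //.
- by move=> k; apply: f_cts; exact: vaught_topology_vaught.
- move=> k; rewrite openE => -[g x] [ug Lx].
  exists (u (code k).1, Ldiff L (code k).2) => //=; split.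
    exact: open_nbhs_nbhs.
  by apply: (@open_nbhs_nbhs (retop tau)); split=> //;
    exact: clopen_refinement_diff.
- move=> x; have [|p [_ _ fp Yp]] := genY setT setT x; last by exists p.
  by apply: vaught_full => //; [exact: openT|exists 1%g].
(* Genericity of the given pair puts its image in the basic transform of a small box, and [genY]
   lifts every point of that transform to a generic pair in the box. *)
- move=> O oO; rewrite retop_openE => _ [[g y] [Ogy Yp] <-].
  have : nbhs (g, y) O by exact: open_nbhs_nbhs.
  move=> [[A B] [/= /nbhs_interior nA /nbhs_interior nB] AB].
  have [n [ng nA']] := u_basis (open_interior A) (nbhs_singleton nA).
  have tB : tau B° by exact: (@open_interior (retop tau) B).
  have [q [qy qB]] := tB _ (nbhs_singleton nB).
  exists (n, q); split.
    by have := Yp (pickle (n, q)); rewrite /Wk /Pk /preimage /= codeK; apply.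
  move=> z /genY[[g' y'] [/= /nA'/interior_subset Ag' /qB/interior_subset By' <- Y']].
  by exists (g', y') => //; split=> //; exact: AB.
- move=> O y oO Yy Oy; exists (f @^-1` O); first exact: f_cts.
  by split.
Qed.

End VaughtTopology.

(** * The refinement *)

(** One family of binary operations suffices: unary operations ignore their second argument. *)
Lemma countable_closure (S : Type) (K : countType) (op : K -> S -> S -> S)
    (D0 : set S) : countable D0 ->
  exists D : set S, [/\ countable D, D0 `<=` D,
    forall k x y, D x -> D y -> D (op k x y) &
    forall P : set S, D0 `<=` P -> (forall k x y, P x -> P y -> P (op k x y)) ->
      D `<=` P].
Proof.
move=> cD0.
pose next (E : set S) := E `|` \bigcup_k [set op k p.1 p.2 | p in E `*` E].
pose lev n := iter n next D0.
have lev_countable n : countable (lev n).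
  elim: n => [//|n IH]; rewrite /lev iterS -/(lev n).
  rewrite /next (_ : _ `|` _ = \bigcup_(o : option K)
    (if o is Some k then [set op k p.1 p.2 | p in lev n `*` lev n] else lev n)).
    apply: bigcup_countable => [|[k|] _//]; first exact: countableP.
    by apply: sub_countable (card_image_le _ _) _; exact: countableX.
  apply/seteqP; split=> [x [nx|[k _ kx]]|x [[k|] _ kx]].
  - by exists None.
  - by exists (Some k).
  - by right; exists k.
  - by left.
have levS m n : (m <= n)%N -> lev m `<=` lev n.
  by move=> /subnK <-; elim: (n - m)%N => [//|k IH x /IH ?]; left.
exists (\bigcup_n lev n); split.
- by apply: bigcup_countable => //; exact: countableP.
- by move=> x Dx; exists 0%N.
- move=> k x y [m _ mx] [n _ ny]; exists (maxn m n).+1 => //; right; exists k => //.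
  by exists (x, y) => //; split; [exact: levS (leq_maxl m n) _ mx|exact: levS (leq_maxr m n) _ ny].
- move=> P D0P Pop x [n _]; elim: n x => [//|n IH] x [/IH//|[k _ [[y z] [/= ny nz] <-]]].
  by apply: Pop; exact: IH.
Qed.

Section LatticeOfSigma0.
Context {G : topologicalGroupType} {X : topologicalType}.
Variable act : G -> X -> X.
Hypothesis actP : continuous_action act.
Hypothesis sieveG : sieve_complete G.
Hypothesis scG : @second_countable G.
Hypothesis scX : @second_countable X.
Variable u : nat -> set G.
Hypothesis u_open : forall n, open (u n).
Hypothesis u_basis : forall g O, open O -> O g -> exists n, u n g /\ u n `<=` O.
Context {d : Order.disp_t} {W : orderType d}.
Hypothesis wfW : well_ordered W.

(** The closure is taken among pairs of a level and a set, so a set may occur with several ranks.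
    Lattice operations take the maximum of the levels, transforms keep the level by [vaught_Sigma0],
    and proper decompositions lower it. *)
Lemma exists_vaught_lattice (xi : W) (K : countType) (eta : K -> W)
    (C : K -> set X) : (exists zeta, (zeta < xi)%O) ->
  (forall k, (eta k < xi)%O) -> (forall k, Sigma0 (eta k) (C k)) ->
  exists (L : nat -> set X) (rank : nat -> W), [/\ lattice_basis L,
    forall k, (rank k < xi)%O /\ Sigma0 (rank k) (L k),
    forall n k, exists c, L c = vaught_transform act (u n) (L k),
    forall k, open (L k) \/ forall x, L k x -> exists a b,
      [/\ (rank a < rank k)%O, (rank b < rank k)%O, (L a `\` L b) x &
        L a `\` L b `<=` L k] &
    forall k, exists c, L c = C k].
Proof.
move=> [zeta0 zeta0xi] etaxi SC.
have [bot botP] := exists_least wfW xi.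
have botxi : (bot < xi)%O := le_lt_trans (botP _) zeta0xi.
pose S := (W * set X)%type.
pose good (e : S) := (e.1 < xi)%O /\ Sigma0 e.1 e.2.
(* The Boolean selects the minuend or the subtrahend; pairs with nothing to decompose return
   themselves. *)
have /choice[dec decP] : forall e : S, exists D : bool -> nat -> S, good e ->
    (forall b i, good (D b i)) /\ (open e.2 \/
     ((forall b i, ((D b i).1 < e.1)%O) /\
      e.2 = \bigcup_i ((D true i).2 `\` (D false i).2))).
  move=> e; have [ge|nge] := pselect (good e); last by exists (fun _ _ => e).
  have [exi Se] := ge; have [[_ oe]|[z [A [B [ze SA SB eE]]]]] := Sigma0P Se.
    by exists (fun _ _ => e) => _; split=> //; left.
  exists (fun b i => (z i, if b then A i else B i)) => _; split=> [b i|].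
    by split=> /=; [exact: lt_trans (ze i) exi|case: b].
  by right; split=> //= b i.
pose op (k : bool + (nat + bool * nat)) (e f : S) : S :=
  match k with
  | inl true => (Order.max e.1 f.1, e.2 `&` f.2)
  | inl false => (Order.max e.1 f.1, e.2 `|` f.2)
  | inr (inl n) => (e.1, vaught_transform act (u n) e.2)
  | inr (inr p) => dec e p.1 p.2
  end.
have [b [b_open b_basis]] := second_countable_enum scX.
pose leaf (k : (nat + bool) + K) : S :=
  match k with
  | inl (inl n) => (bot, b n)
  | inl (inr c) => (bot, if c then setT else set0)
  | inr k => (eta k, C k)
  end.
have [D [cD leafD opD Dmin]] := @countable_closure S _ op (range leaf)
  (sub_countable (card_image_le _ _) (countableP _)).
have Dgood : D `<=` good.
  apply: Dmin => [_ [k _ <-]|k e f [exi Se] [fxi Sf]].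
    case: k => [[n|c]|k] /=; split=> //=; apply: open_Sigma0 => //.
    by case: c; [exact: openT|exact: open0].
  have le1 : (e.1 <= Order.max e.1 f.1)%O by rewrite le_max lexx.
  have le2 : (f.1 <= Order.max e.1 f.1)%O by rewrite le_max lexx orbT.
  have maxxi : (Order.max e.1 f.1 < xi)%O by rewrite gt_max exi fxi.
  case: k => [[]|[n|p]] /=.
  - by split=> //; apply: Sigma0I => //; [exact: Sigma0W le1 Se|exact: Sigma0W le2 Sf].
  - by split=> //; apply: Sigma0U => //; [exact: Sigma0W le1 Se|exact: Sigma0W le2 Sf].
  - by split=> //; exact: (vaught_Sigma0 actP sieveG scG u_open u_basis).
  - by case: (decP e) => // gd _; exact: gd.
have leafP k : D (leaf k) by apply: leafD; exists k.
have [e [eD De]] := countable_enum (leaf (inl (inr false))) cD.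
have {}eD k : D (e k) by case: (eD k) => [//|->].
have De2 s : D s -> exists c, (e c).2 = s.2 by move=> /De[c <-]; exists c.
exists (fun k => (e k).2), (fun k => (e k).1); split.
- split.
  + by move=> k l; have := opD (inl true) _ _ (eD k) (eD l) => /De2.
  + by move=> k l; have := opD (inl false) _ _ (eD k) (eD l) => /De2.
  + exact: De2 (leafP (inl (inr false))).
  + exact: De2 (leafP (inl (inr true))).
  + move=> x O oO Ox; have [n [nx nO]] := b_basis x O oO Ox.
    by have [c cE] := De2 _ (leafP (inl (inl n))); exists c; rewrite cE; split=> //; exact: b_open.
- by move=> k; exact: Dgood (eD k).
- by move=> n k; have := opD (inr (inl n)) _ _ (eD k) (eD k) => /De2.
- move=> k; have [_ [oe|[lt eE]]] := decP (e k) (Dgood _ (eD k)); first by left.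
  right=> x; rewrite {1}eE => -[i _ xi'].
  have [p pE] := De _ (opD (inr (inr (true, i))) _ _ (eD k) (eD k)).
  have [q qE] := De _ (opD (inr (inr (false, i))) _ _ (eD k) (eD k)).
  exists p, q; rewrite pE qE /=; split=> // y yi.
  by rewrite eE; exists i.
- by move=> k; exact: De2 (leafP (inr k)).
Qed.

End LatticeOfSigma0.

(** The basis [u] of [G] is a parameter, so that one construction serves both claims: a suitable
    choice of [u] gives zero-dimensionality. *)
Lemma exists_good_refinement (R : realType) (G : topologicalGroupType)
    (X : topologicalType) (act : G -> X -> X) (u : nat -> set G)
    (d : Order.disp_t) (W : orderType d) (xi : W)
    (I : countType) (A : I -> set X) :
  polish R G -> quasi_polish R X -> continuous_action act ->
  (forall n, open (u n)) ->
  (forall g O, open O -> O g -> exists n, u n g /\ u n `<=` O) ->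
  well_ordered W -> (exists zeta : W, (zeta < xi)%O) ->
  (forall i, Sigma0 xi (A i)) ->
  exists t : topology X, good_refinement act R xi A t /\
    ((forall n, exists2 H, open_subgroup H &
       forall h l, H h -> u n l -> u n (h * l)%g) ->
     has_clopen_basis (retop t)).
Proof.
move=> [scG [dG [mG cG qG]]] [scX [dX [mX cX qX]]] actP u_open u_basis wfW ltxi SA.
have sieveG : sieve_complete G by exact: quasi_complete_sieve mG.1 cG qG.
have sieveX : sieve_complete X by exact: quasi_complete_sieve mX cX qX.
have [zeta0 zeta0xi] := ltxi.
have /choice[D DP] : forall i, exists D : (nat -> W) * (nat -> bool -> set X),
    [/\ forall j, (D.1 j < xi)%O, forall j b, Sigma0 (D.1 j) (D.2 j b) &
      A i = \bigcup_j (D.2 j true `\` D.2 j false)].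
  move=> i; have [z [U [V [zx SU SV AE]]]] := Sigma0_bigcupP zeta0xi (SA i).
  by exists (z, fun j b => if b then U j else V j); split=> // j [].
have [||L [rank [latticeL Lrank L_vaught L_decomp LC]]] :=
  @exists_vaught_lattice G X act actP sieveG scG scX u u_open u_basis d W wfW xi
    (I * nat * bool)%type (fun k => (D k.1.1).1 k.1.2)
    (fun k => (D k.1.1).2 k.1.2 k.2) ltxi.
- by move=> [[i j] b]; case: (DP i).
- by move=> [[i j] b]; case: (DP i).
have L_Sigma0 k : Sigma0 (rank k) (L k) := (Lrank k).2.
pose t := vaught_topology actP sieveG scG u_open u_basis latticeL L_Sigma0 L_vaught.
have t_finer : @open X `<=` t by exact: vaught_topology_finer.
have t_regular : regular_space (retop t) by exact: vaught_topology_regular.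
have t_vaught U i : open U -> t (vaught_transform act U (A i)).
  move=> oU; have [_ _ AE] := DP i.
  rewrite (_ : vaught_transform _ _ _ = \bigcup_j
    vaught_transform act U ((D i).2 j true `\` (D i).2 j false)); last first.
    apply/seteqP; split=> x; first by rewrite AE => /(vaught_bigcup actP)[j jx]; exists j.
    move=> [j _]; apply: (vaughtS actP) => // y jy.
    by rewrite AE; exists j.
  apply: (@bigcup_open (retop t)) => j _.
  have [b bE] := LC (i, j, true); have [c cE] := LC (i, j, false).
  rewrite /= in bE cE; rewrite -bE -cE.
  exact: (@vaught_topology_vaught _ _ _ _ _ _ _ _ _ _ _ _ _ _ _ _ U (b, c)).
exists t; split; last exact: vaught_topology_clopen.
split; last first.
  (* For an invariant set the return set of a point is all of [G] or empty, so the transform by [G]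
     is the set itself. *)
  move=> i inv; rewrite (_ : A i = vaught_transform act setT (A i)).
    by apply: t_vaught; exact: openT.
  apply/seteqP; split=> x; last first.
    by move=> /(vaught_witness actP)[g [_ /(act_imageE actP)]]; rewrite inv.
  move=> Ax; apply: vaught_full => //; [exact: openT|by exists 1%g|].
  by move=> g _; apply/(act_imageE actP); rewrite inv.
split=> //.
- apply: sieve_complete_polish.
  + exact: vaught_topology_sieve.
  + exact: vaught_topology_second_countable.
  + exact: t_regular.
  + apply: regular_T0_T1 => // x y xy.
    (* Balls of the quasi-metric are open in [t], so points that [t] does not distinguish are at
       distance 0 both ways. *)
    have [d0 dE _] := mX; apply/dE.
    have dxx z : dX z z = 0 by have [/(_ erefl)[]] := dE z z.
    have near0 v w : (forall O, t O -> O v -> O w) -> dX v w = 0.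
      move=> vw; apply/eqP; rewrite eq_le d0 andbT leNgt; apply/negP => pos.
      have := vw [set z | dX v z < dX v w]; rewrite /= dxx ltxx.
      by move=> h; have := h (t_finer _ (quasi_ball_open _ _ mX cX)) pos.
    by split; apply: near0 => O oO; [exact: (xy O oO).1|exact: (xy O oO).2].
- by apply: vaught_topology_Sigma0 => // k; exact: (Lrank k).1.
- exact: vaught_topology_action.
Qed.

Theorem theorem3p6p5 (R : realType) (G : topologicalGroupType)
    (X : topologicalType) (act : G -> X -> X)
    (d : Order.disp_t) (W : orderType d) (xi : W)
    (I : countType) (A : I -> set X) :
  polish R G ->
  quasi_polish R X ->
  continuous_action act ->
  well_ordered W ->
  countable [set zeta : W | (zeta < xi)%O] ->
  (exists zeta : W, (zeta < xi)%O) ->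
  (forall i, Sigma0 xi (A i)) ->
  (exists t : topology X, good_refinement act R xi A t) /\
  (non_archimedean G ->
   exists t : topology X,
     good_refinement act R xi A t /\ has_clopen_basis (retop t)).
Proof.
move=> pG qX actP wfW _ ltxi SA; split.
  have [u [u_open u_basis]] := second_countable_enum pG.1.
  have [t [tP _]] :=
    exists_good_refinement pG qX actP u_open u_basis wfW ltxi SA.
  by exists t.
move=> naG.
(* Open sets that are unions of right cosets of an open subgroup. *)
pose B := [set U : set G | open U /\ exists2 H, open_subgroup H &
  forall h l, H h -> U l -> U (h * l)%g].
have mulr_cts (g : G) : continuous (fun h : G => (h * g)%g).
  move=> h; apply: (@continuous_comp G (G * G)%type G (fun k => (k, g))
    (fun p => (p.1 * p.2)%g)); last exact: mulg_continuous.
  by apply: cvg_pair; [exact: cvg_id|exact: cvg_cst].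
have [||u [uB u_basis]] := @second_countable_basis_enum G B pG.1.
- by move=> U [].
- move=> g O oO Og.
  have [|H HP HO] := naG ((fun h : G => (h * g)%g) @^-1` O).
    apply: open_nbhs_nbhs; split; last by rewrite /preimage /= mul1g.
    by have /continuousP := @mulr_cts g; apply.
  have [oH H1 HM _] := HP.
  (* This is the right coset H g, included in [O] because [H] lies in O g^-1. *)
  exists ((fun h : G => (h * g^-1)%g) @^-1` H).
    split; first by have /continuousP := @mulr_cts g^-1%g; apply.
    by exists H => // h l Hh Hl; rewrite /preimage /= -mulgA; exact: HM.
  split; first by rewrite /preimage /= mulgV.
  by move=> l /HO; rewrite /preimage /= -mulgA mulVg mulg1.
(* The empty set, a possible value of the enumeration, is also a member of [B]. *)
have {}uB n : B (u n).
  case: (uB n) => [//|->]; split; first exact: open0.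
  by have [H HP _] := naG setT filterT; exists H.
have [t [tP tc]] :=
  exists_good_refinement pG qX actP (fun n => (uB n).1) u_basis wfW ltxi SA.
by exists t; split=> //; apply: tc => n; exact: (uB n).2.
Qed.
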